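(* Let $n\geq 1$ be an integer. (1) The Hilbert $C(\mathbb T^n)$-module $\Xi$ is isomorphic to the standard Hilbert $C(\mathbb T^n)$-module $$l^2(C(\mathbb T^n))=\Big\{(f_j)_{j=1}^{\infty}: f_j\in C(\mathbb T^n),\ \sum_{j=1}^{\infty}|f_j|^2\ \text{converges in norm in } C(\mathbb T^n)\Big\}.$$ (2) If $\Phi:\mathbb R^n\to\mathbb C$ is a continuous function, then $\Phi\in\Xi$ if and only if the sum $\sum_{p\in\mathbb Z^n}|\Phi(x-p)|^2$ converges uniformly in $x$ on the cube $[0,1]^n$.
   Context: Functions in $C(\mathbb T^n)$ are identified with continuous $\mathbb Z^n$-periodic functions $\mathbb R^n\to\mathbb C$. $\Xi$ is the right Hilbert $C(\mathbb T^n)$-module obtained by completing $C_c(\mathbb R^n)$ with respect to the norm $\|\xi\|=\|\langle\xi,\xi\rangle_{C(\mathbb T^n)}\|_\infty^{1/2}$ determined by the $C(\mathbb T^n)$-valued inner product $$\langle \xi,\eta\rangle_{C(\mathbb T^n)}(t)=\sum_{p\in\mathbb Z^n}(\overline{\xi}\,\eta)(t-p),\qquad t\in\mathbb R^n,$$ with right action of $C(\mathbb T^n)$ by pointwise multiplication. Since this norm dominates the supremum norm, elements of the completion $\Xi$ are regarded as continuous bounded functions on $\mathbb R^n$. The inner product on $l^2(C(\mathbb T^n))$ is $\langle (f_j),(g_j)\rangle=\sum_j \overline{f_j}g_j$, with right action of $C(\mathbb T^n)$ by entrywise multiplication. *)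

(* Defs.v *)
From HB Require Import structures.
From mathcomp Require Import all_boot all_order all_algebra finmap.
From mathcomp Require Import complex.
From mathcomp Require Import all_classical all_reals all_analysis.
From mathcomp Require Import showcase.summability.

Set Implicit Arguments.
Unset Strict Implicit.
Unset Printing Implicit Defensive.

Import Order.TTheory GRing.Theory Num.Theory.
Import numFieldNormedType.Exports.

Local Open Scope classical_set_scope.
Local Open Scope ring_scope.

(* MathComp-Analysis puts the norm topology on abstract numeric fields but not
   on the concrete type [R[i]]. *)
HB.instance Definition _ (R : realType) :=
  NormedModule.copy R[i] (R[i]^o).

Section HilbertModules.
Variables (R : realType) (n : nat).

Local Notation C := R[i].
Local Notation Rn := 'rV[R]_n.
Local Notation Zn := 'rV[int]_n.

Definition translate (p : Zn) (t : Rn) : Rn := t - map_mx intr p.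

Definition CT : set (Rn -> C) :=
  [set f | continuous f /\ forall p t, f (translate p t) = f t].

Definition supnorm (f : Rn -> C) : R := sup [set complex.Re `|f t| | t in setT].

Definition Cc : set (Rn -> C) :=
  [set xi | continuous xi /\ compact (closure [set t | xi t != 0])].

(* [\sum_(p \in setT)] is the sum of a finitely supported family; for [xi] and
   [eta] in [Cc] only finitely many terms are nonzero at each [t]. *)
Definition Cc_dot (xi eta : Rn -> C) : Rn -> C := fun t =>
  \sum_(p \in [set: Zn]) (xi (translate p t))^* * eta (translate p t).

Definition Cc_norm (xi : Rn -> C) : R := Num.sqrt (supnorm (Cc_dot xi xi)).

Definition Cc_cauchy (xi : nat -> Rn -> C) : Prop :=
  forall e : R, 0 < e -> \forall k & l \near \oo, Cc_norm (xi k - xi l) < e.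

(* [xi] is a Cauchy sequence of [Cc] whose class in the completion is the
   function [Phi].  As [Cc_norm] dominates the supremum norm, the class of a
   Cauchy sequence is regarded as the uniform limit of the sequence. *)
Definition Xi_rep (xi : nat -> Rn -> C) (Phi : Rn -> C) : Prop :=
  [/\ forall k, Cc (xi k), Cc_cauchy xi & {uniform, xi @ \oo --> Phi}].

Definition Xi : set (Rn -> C) := [set Phi | exists xi, Xi_rep xi Phi].

(* The extension of [Cc_dot] to the completion by continuity: on [Xi] there is
   exactly one such [h], and off [Xi] the value is irrelevant. *)
Definition Xi_dot (Phi Psi : Rn -> C) : Rn -> C :=
  get [set h : Rn -> C | forall xi eta, Xi_rep xi Phi -> Xi_rep eta Psi ->
    {uniform, (fun k => Cc_dot (xi k) (eta k)) @ \oo --> h}].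

Definition Xi_act (Phi a : Rn -> C) : Rn -> C := Phi * a.

(* Convergence in norm in C(T^n) is uniform convergence; indices start at 0. *)
Definition l2 : set (nat -> Rn -> C) :=
  [set f : nat -> Rn -> C | (forall j, CT (f j)) /\
    exists2 g : Rn -> C, CT g &
      {uniform, (fun N (t : Rn) => \sum_(j < N) `|f j t| ^+ 2 : C)
        @ \oo --> g}].

Definition l2_dot (f g : nat -> Rn -> C) : Rn -> C :=
  get [set h : Rn -> C | {uniform,
    (fun N (t : Rn) => \sum_(j < N) (f j t)^* * g j t : C) @ \oo --> h}].

Definition l2_act (f : nat -> Rn -> C) (a : Rn -> C) : nat -> Rn -> C :=
  fun j => f j * a.

(* Isomorphism of Hilbert C(T^n)-modules: a C(T^n)-linear bijection preserving
   the inner products.  A module is given by its underlying set [X] in an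
   additive group [E], its right action and its inner product.  Linearity over
   the scalars is the case of constant [a]. *)
Definition hilbert_iso (E F : zmodType)
    (X : set E) (actX : E -> (Rn -> C) -> E) (dotX : E -> E -> Rn -> C)
    (Y : set F) (actY : F -> (Rn -> C) -> F) (dotY : F -> F -> Rn -> C) : Prop :=
  exists U : E -> F,
    [/\ set_bij X Y U,
        forall x y, X x -> X y -> U (x + y) = U x + U y,
        forall x a, X x -> CT a -> U (actX x a) = actY (U x) a
      & forall x y, X x -> X y -> dotY (U x) (U y) = dotX x y].

Definition cube : set Rn := [set x | forall i, 0 <= x ord0 i <= 1].

(* A sum over Z^n is the limit of its finite partial sums along the directed
   set of finite subsets of Z^n. *)
Definition translates_sum_cvg_unif (Phi : Rn -> C) : Prop :=
  exists s : Rn -> C,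
    {uniform cube,
      (fun (A : {fset Zn}) (x : Rn) =>
         \sum_(p <- A) `|Phi (translate p x)| ^+ 2 : C) @ totally --> s}.

End HilbertModules.

(* Main.v *)
(* On the cube [0,1]^n, a function [Phi] in [Xi] is the family of square summable
   sequences [p |-> Phi (t - p)], and periodicity glues the fibres over opposite
   faces by the shifts of l^2(Z^n).  So [Xi] becomes l^2(C(T^n)) once there is a
   norm-continuous path of unitaries of l^2(Z) from the identity to the
   bilateral shift.  The shift is the product [P Q] of the reflections
   [P : e_p |-> e_(-p)] and [Q : e_p |-> e_(1-p)], and
     (sqrt (1 - t) + i sqrt t P) (sqrt (1 - t) - i sqrt t Q),   0 <= t <= 1,
   is such a path.  All its rows and columns have at most four nonzero entries,
   so its rows are the fibres of compactly supported continuous functions on R;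
   their tensor products form an orthonormal basis of [Xi] indexed by Z^n, whose
   coefficient map and its inverse are given by finite sums at every point.
   Membership in [Xi], in l^2(C(T^n)), and uniform convergence of the sum of the
   translates all amount to uniformly small tails of square sums on the cube,
   and unitaries with finite rows and columns preserve this condition. *)

Require Import Defs.
From mathcomp Require Import all_boot all_order all_algebra finmap.
From mathcomp Require Import complex.
From mathcomp Require Import all_classical all_reals all_analysis.
From mathcomp Require Import showcase.summability.
From mathcomp Require Import ring lra zify.

Set Implicit Arguments.
Unset Strict Implicit.
Unset Printing Implicit Defensive.
Import Order.TTheory GRing.Theory Num.Theory.
Import numFieldNormedType.Exports.
Local Open Scope classical_set_scope.
Local Open Scope ring_scope.

(** * Unitary matrices with finite rows and columns *)

Section FiniteBandUnitary.
Local Open Scope fset_scope.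
Variables (C : numClosedFieldType) (I J : choiceType).

Lemma big_fset_delta (A : {fset I}) (p : I) (F : I -> C) :
  p \in A -> \sum_(q <- A) (p == q)%:R * F q = F p.
Proof.
move=> pA; rewrite (big_fsetD1 p) //= eqxx mul1r big1_fset ?addr0 // => q.
by rewrite !inE eq_sym => /andP[/negPf-> _] _; rewrite mul0r.
Qed.

(** Each orthogonality sum runs over the support of one of its two rows or columns, so it is finite
    and complete. Both relations are imposed because an isometry of an infinite-dimensional space
    need not be onto. *)
Definition finitary_unitary (G : J -> I -> C) (rs : J -> {fset I})
    (cs : I -> {fset J}) : Prop :=
  [/\ forall m p, G m p != 0 -> p \in rs m,
      forall m p, G m p != 0 -> m \in cs p,
      forall m l, \sum_(p <- rs m) (G m p)^* * G l p = (m == l)%:R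
    & forall p q, \sum_(m <- cs p) G m p * (G m q)^* = (p == q)%:R].

(** The coefficient of [f] along row [m]; rows being finite, it makes sense for every family [f],
    square-summable or not. *)
Definition transform (G : J -> I -> C) (rs : J -> {fset I}) (f : I -> C) m : C :=
  \sum_(p <- rs m) (G m p)^* * f p.

Lemma transform_widen G rs cs (f : I -> C) m (A : {fset I}) :
  finitary_unitary G rs cs -> rs m `<=` A ->
  transform G rs f m = \sum_(p <- A) (G m p)^* * f p.
Proof.
move=> [Grs _ _ _] sA; apply: big_fset_incl => // p _ pm.
by have /eqP-> : G m p == 0; rewrite ?conjC0 ?mul0r //; apply: contraNT pm => /Grs.
Qed.

End FiniteBandUnitary.

Section Adjoint.
Local Open Scope fset_scope.
Variables (C : numClosedFieldType) (I J : choiceType).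
Variables (G : J -> I -> C) (rs : J -> {fset I}) (cs : I -> {fset J}).
Hypothesis GU : finitary_unitary G rs cs.

Definition adjoint_mx (p : I) (m : J) : C := (G m p)^*.

Lemma adjoint_unitary : finitary_unitary adjoint_mx cs rs.
Proof.
case: GU => Grs Gcs Go Gc; split => [p m|p m|p q|m l]; rewrite /adjoint_mx.
- by rewrite conjC_eq0 => /Gcs.
- by rewrite conjC_eq0 => /Grs.
- by rewrite -Gc; apply: eq_bigr => m _; rewrite conjCK.
- by rewrite -Go; apply: eq_bigr => p _; rewrite conjCK.
Qed.

(** All sums are finite, so they may be exchanged, and column orthogonality leaves only the entry at
    [p]. No summability of [f] enters. *)
Lemma transformK (f : I -> C) :
  transform adjoint_mx cs (transform G rs f) = f.
Proof.
apply/funext => p; rewrite /transform /adjoint_mx.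
pose B := p |` \bigcup_(m <- cs p) rs m.
have -> : \sum_(m <- cs p) ((G m p)^*)^* * (\sum_(q <- rs m) (G m q)^* * f q) =
    \sum_(m <- cs p) \sum_(q <- B) G m p * (G m q)^* * f q.
  apply: eq_big_seq => m mp /=.
  rewrite -/(transform G rs f m) (transform_widen f GU (A := B)).
    by rewrite conjCK mulr_sumr; apply: eq_bigr => q _; rewrite mulrA.
  rewrite /B fsubsetU //; apply/orP; right.
  exact: bigfcup_sup.
rewrite exchange_big /=.
have [_ _ _ Gc] := GU; under eq_bigr => q _ do rewrite -mulr_suml Gc.
by rewrite big_fset_delta // /B !inE eqxx.
Qed.

Lemma transform_supp (f : I -> C) (A : {fset I}) m :
  (forall p, p \notin A -> f p = 0) ->
  transform G rs f m = \sum_(p <- A) (G m p)^* * f p.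
Proof.
move=> fA; rewrite (transform_widen f GU (fsubsetUr A (rs m))); apply/esym.
by apply: big_fset_incl (fsubsetUl _ _) _ => p _ /fA ->; rewrite mulr0.
Qed.

(** For each [p] in [A], the sum over [m] applies the adjoint to the coefficients of [g], which
    returns [g p]; [M] contains every column index this requires. *)
Lemma finite_parseval (f g : I -> C) (A : {fset I}) (M : {fset J}) :
  (forall p, p \notin A -> f p = 0) -> \bigcup_(p <- A) cs p `<=` M ->
  \sum_(m <- M) (transform G rs f m)^* * transform G rs g m =
  \sum_(p <- A) (f p)^* * g p.
Proof.
move=> fA sM.
under eq_bigr => m _ do rewrite (transform_supp _ fA) rmorph_sum mulr_suml.
rewrite exchange_big /=; apply: eq_big_seq => p pA /=.
have := congr1 (@^~ p) (transformK g) => <-.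
rewrite (transform_widen _ adjoint_unitary (A := M)).
  rewrite mulr_sumr; apply: eq_bigr => m _.
  by rewrite /adjoint_mx rmorphM mulrCA mulrA.
by apply: fsubset_trans sM; exact: bigfcup_sup.
Qed.

(** Coefficients in [M] see only finitely many entries of [f], so [f] may be truncated to them.
    Parseval applies to the truncation over a larger index set, and the extra squares are
    dropped. *)
Lemma bessel (f : I -> C) (M : {fset J}) (K : C) :
  (forall B : {fset I}, \sum_(p <- B) `|f p| ^+ 2 <= K) ->
  \sum_(m <- M) `|transform G rs f m| ^+ 2 <= K.
Proof.
move=> fK; pose A := \bigcup_(m <- M) rs m.
pose f' p := if p \in A then f p else 0.
have f'A p : p \notin A -> f' p = 0 by rewrite /f' => /negPf ->.
have Uff' m : m \in M -> transform G rs f m = transform G rs f' m.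
  move=> mM; apply: eq_big_seq => p pm /=; rewrite /f' ifT //.
  by apply: fsubsetP p pm; exact: bigfcup_sup.
apply: le_trans (fK A).
have -> : \sum_(p <- A) `|f p| ^+ 2 = \sum_(p <- A) (f' p)^* * f' p.
  by apply: eq_big_seq => p pA /=; rewrite /f' pA normCK mulrC.
rewrite -(finite_parseval f' f'A (fsubsetUr M _)).
rewrite (eq_big_seq (fun m => `|transform G rs f' m| ^+ 2)); last first.
  by move=> m /Uff' ->.
rewrite [leRHS](eq_bigr (fun m => `|transform G rs f' m| ^+ 2)); last first.
  by move=> m _; rewrite normCK mulrC.
rewrite [leRHS](big_fsetID _ (mem M)) /=.
have -> : [fset x in M `|` \bigcup_(p <- A) cs p | x \in M] = M.
  by apply/fsetP => m; rewrite !inE /=; case: (m \in M) => /=; rewrite ?andbF.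
by rewrite lerDl sumr_ge0 // => m _; rewrite exprn_ge0.
Qed.

End Adjoint.

(* The weighted inequality |a b| <= c |a|^2 + |b|^2 / c replaces Cauchy-Schwarz, so
   that no square roots are needed. *)
Lemma norm_dot_le (C : numClosedFieldType) (J : choiceType) (x y : J -> C)
    (M : seq J) (c : C) : 0 < c ->
  `|\sum_(m <- M) (x m)^* * y m| <=
  c * \sum_(m <- M) `|x m| ^+ 2 + c^-1 * \sum_(m <- M) `|y m| ^+ 2.
Proof.
move=> c0; apply: le_trans (ler_norm_sum _ _ _) _.
rewrite !mulr_sumr -big_split /=; apply: ler_sum => m _.
rewrite normrM norm_conjC.
have [|] := orP (ger_leVge (mulr_ge0 (ltW c0) (normr_ge0 (x m))) (normr_ge0 (y m))).
  rewrite -ler_pdivlMl // => h; rewrite -[leLHS]add0r lerD //.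
    by rewrite mulr_ge0 ?exprn_ge0 // ltW.
  by rewrite expr2 mulrA ler_wpM2r.
move=> h; rewrite -[leLHS]addr0 lerD //.
  by rewrite mulrC expr2 mulrA ler_wpM2r.
by rewrite mulr_ge0 ?exprn_ge0 // invr_ge0 ltW.
Qed.

Lemma norm_dot_small (C : numClosedFieldType) (J : choiceType) (K e : C) :
  0 < K -> 0 < e -> exists2 d : C, 0 < d & forall (x y : J -> C) (M : seq J),
    \sum_(m <- M) `|x m| ^+ 2 <= d -> \sum_(m <- M) `|y m| ^+ 2 <= K ->
    `|\sum_(m <- M) (x m)^* * y m| <= e.
Proof.
move=> K0 e0; have e20 : 0 < e / 2 by rewrite divr_gt0.
(* With [c = K / (e / 2)] the bounded factor contributes at most [e / 2]; [d] is chosen as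
   [(e / 2) / c], so that the small factor does too. *)
have c0 : 0 < K / (e / 2) by rewrite divr_gt0.
exists (e / 2 / (K / (e / 2))) => [|x y M xd yK]; first by rewrite divr_gt0.
apply: le_trans (norm_dot_le _ _ _ c0) _.
rewrite [leRHS]splitr; apply: lerD; first by rewrite mulrC -ler_pdivlMr.
by rewrite mulrC ler_pdivrMr // mulrCA divff ?mulr1 // gt_eqF.
Qed.

(** * Uniformly small tails of square sums, and their behaviour under unitaries *)

Section UniformSquareSum.
Local Open Scope fset_scope.
Variables (C : numClosedFieldType) (X : Type) (D : set X).

(** The Cauchy form of uniform convergence of the square sums on [D], in which no limit function is
    named. The condition [0 < e] in [C] forces [e] to be real. *)
Definition sqsum_tail (I : choiceType) (f : X -> I -> C) : Prop :=
  forall e : C, 0 < e -> exists A0 : {fset I}, forall (B : {fset I}) x, D x ->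
    \sum_(p <- B `\` A0) `|f x p| ^+ 2 <= e.

Definition sqsum_bounded (I : choiceType) (f : X -> I -> C) : Prop :=
  exists2 K : C, 0 < K & forall (B : {fset I}) x, D x ->
    \sum_(p <- B) `|f x p| ^+ 2 <= K.

Definition dot_cvg (I : choiceType) (f g : X -> I -> C) (h : X -> C) : Prop :=
  forall e : C, 0 < e -> exists A0 : {fset I}, forall A : {fset I}, A0 `<=` A ->
    forall x, D x -> `|\sum_(p <- A) (f x p)^* * g x p - h x| <= e.

(** The sum over the tail is the difference of the partial sums over [A0] joined with [B] and over
    [A0], both close to [h]. *)
Lemma dot_cvg_tail (I : choiceType) (f : X -> I -> C) h :
  dot_cvg f f h -> sqsum_tail f.
Proof.
move=> fh e e0; have e20 : 0 < e / 2 by rewrite divr_gt0.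
have [A0 A0P] := fh _ e20; exists A0 => B x Dx.
have h1 := A0P A0 (fsubset_refl _) x Dx.
have h2 := A0P (A0 `|` B) (fsubsetUl _ _) x Dx.
have -> : \sum_(p <- B `\` A0) `|f x p| ^+ 2 =
    `|\sum_(p <- A0 `|` B) (f x p)^* * f x p - \sum_(p <- A0) (f x p)^* * f x p|.
  rewrite (big_fsetID _ (mem A0) (A0 `|` B)) /=.
  have -> : [fset p in A0 `|` B | p \in A0] = A0.
    by apply/fsetP => p; rewrite !inE /=; case: (p \in A0); rewrite ?andbF.
  have -> : [fset p in A0 `|` B | p \notin A0] = B `\` A0.
    by apply/fsetP => p; rewrite !inE /=; case: (p \in A0); rewrite ?andbF ?andbT.
  rewrite addrAC subrr add0r.
  rewrite [in RHS](eq_bigr (fun p => `|f x p| ^+ 2)); last first.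
    by move=> p _; rewrite normCK mulrC.
  by rewrite ger0_norm // sumr_ge0 // => p _; rewrite exprn_ge0.
rewrite distrC in h1; rewrite (splitr e).
exact: le_trans (ler_distD (h x) _ _) (lerD h2 h1).
Qed.

Lemma tail_dot_cauchy (I : choiceType) (f g : X -> I -> C) :
  sqsum_tail f -> sqsum_bounded g ->
  forall e : C, 0 < e -> exists A0 : {fset I}, forall (B : {fset I}) x, D x ->
    `|\sum_(p <- B `\` A0) (f x p)^* * g x p| <= e.
Proof.
move=> ft [K K0 gK] e e0.
have [d d0 dP] := norm_dot_small I K0 e0.
have [A0 A0P] := ft _ d0; exists A0 => B x Dx.
by apply: dP; [exact: A0P|exact: gK].
Qed.

Variables (I J : choiceType) (G : X -> J -> I -> C).
Variables (rs : J -> {fset I}) (cs : I -> {fset J}).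
Hypothesis GU : forall x, D x -> finitary_unitary (G x) rs cs.

Local Notation U f := (fun x => transform (G x) rs (f x)).

Lemma transform_bounded (f : X -> I -> C) : sqsum_bounded f -> sqsum_bounded (U f).
Proof.
move=> [K K0 fK]; exists K => // M x Dx.
by apply: (bessel (GU Dx)) => B; exact: fK.
Qed.

(** Split [f] into its restriction [f1] to a large finite set and the rest [f2]. Parseval evaluates
    the [f1] part exactly; Bessel keeps the coefficients of [f2] small, and they are paired with
    bounded ones. The supports [rs] and [cs] do not depend on [x], which makes this uniform. *)
Lemma transform_dot_cvg (f g : X -> I -> C) (h : X -> C) :
  sqsum_tail f -> sqsum_bounded g -> dot_cvg f g h -> dot_cvg (U f) (U g) h.
Proof.
move=> ft gb fgh e e0.
have e20 : 0 < e / 2 by rewrite divr_gt0.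
have [K K0 gK] := transform_bounded gb.
have [d d0 dP] := norm_dot_small J K0 e20.
have [A1 A1P] := ft _ d0.
have [A2 A2P] := fgh _ e20.
pose A := A1 `|` A2; exists (\bigcup_(p <- A) cs p) => M sM x Dx.
pose f1 p := if p \in A then f x p else 0.
pose f2 p := if p \in A then 0 else f x p.
have Uf m : U f x m = (transform (G x) rs f1 m + transform (G x) rs f2 m)%R.
  rewrite /transform -big_split /=; apply: eq_bigr => p _.
  by rewrite -mulrDr /f1 /f2; case: ifP; rewrite ?addr0 ?add0r.
have f1A p : p \notin A -> f1 p = 0 by rewrite /f1 => /negPf ->.
under eq_bigr => m _ do rewrite Uf rmorphD mulrDl.
rewrite big_split /= (finite_parseval (GU Dx) (g x) f1A sM) addrAC.
rewrite [leRHS]splitr; apply: le_trans (ler_normD _ _) (lerD _ _).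
  rewrite (eq_big_seq (fun p => (f x p)^* * g x p)).
    by apply: A2P => //; exact: fsubsetUr.
  by move=> p pA /=; rewrite /f1 pA.
apply: dP; last exact: gK.
apply: (bessel (GU Dx)) => B.
apply: le_trans (A1P B x Dx).
rewrite (big_fsetID _ (mem A1)) /= big1_fset ?add0r => [|p].
  have -> : [fset p in B | p \notin A1] = B `\` A1.
    by apply/fsetP => p; rewrite !inE /= andbC.
  apply: ler_sum => p _; rewrite /f2; case: ifP => // _.
  by rewrite normr0 expr0n exprn_ge0.
by rewrite !inE /= /f2 /A => /andP[_ pA] _; rewrite inE pA normr0 expr0n.
Qed.

End UniformSquareSum.

(** * A path of unitaries from the identity to the bilateral shift *)

Section BilateralShift.
Variable R : rcfType.
Local Notation C := R[i].
Implicit Types (t : R) (m p k : int).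

(** Summation over the integers from [-N] to [N], indexed by ordinals so that a product over
    coordinates distributes over it. *)
Definition zsum (N : nat) (F : int -> C) : C :=
  \sum_(j < (2 * N).+1) F (j%:Z - N%:Z).

Lemma zsum_delta N a (F : int -> C) : (`|a| <= N)%N ->
  zsum N (fun p => (p == a)%:R * F p) = F a.
Proof.
move=> aN; have jlt : (absz (a + N%:Z)%R < (2 * N).+1)%N by lia.
rewrite /zsum (bigD1 (Ordinal jlt)) //=.
have -> : (absz (a + N%:Z)%R)%:Z - N%:Z = a by lia.
rewrite eqxx mul1r big1 ?addr0 // => j /eqP jne.
case: eqP => [ja|]; last by rewrite mul0r.
by case: jne; apply/val_inj => /=; lia.
Qed.

Lemma zsumD N (F F' : int -> C) :
  zsum N (fun p => F p + F' p) = zsum N F + zsum N F'.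
Proof. exact: big_split. Qed.

Lemma eq_zsum N (F F' : int -> C) : F =1 F' -> zsum N F = zsum N F'.
Proof. by move=> FF'; apply: eq_bigr => j _; exact: FF'. Qed.

(* The matrix of (sqrt (1 - t) + i sqrt t P) (sqrt (1 - t) - i sqrt t Q). *)
Definition shift_path t m p : C :=
  Complex ((1 - t) * (p == m)%:R + t * (p == m + 1)%:R)
          (Num.sqrt (t * (1 - t)) * ((p == - m)%:R - (p == 1 - m)%:R)).

(** The row has entries at [m], [m + 1], [-m] and [1 - m]; written as a sum of deltas it needs no
    case distinction when positions coincide. The strict bound on [m] keeps all four in range. *)
Lemma shift_path_row t m l N : 0 <= t <= 1 -> (`|m| < N)%N ->
  zsum N (fun p => (shift_path t m p)^* * shift_path t l p) = (m == l)%:R.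
Proof.
move=> /andP[t0 t1] mN.
set w := Num.sqrt (t * (1 - t)).
have w2 : w * w - t * (1 - t) = 0.
  by rewrite -expr2 sqr_sqrtr ?subrr // mulr_ge0 // subr_ge0.
transitivity (zsum N (fun p => (p == m)%:R * ((1 - t)%:C%C * shift_path t l p) +
    ((p == m + 1)%:R * (t%:C%C * shift_path t l p) +
    ((p == - m)%:R * (Complex 0 (- w) * shift_path t l p) +
     (p == 1 - m)%:R * (Complex 0 w * shift_path t l p))))).
  apply: eq_zsum => p; rewrite !mulrA -!mulrDl; congr (_ * _).
  apply/eqP; rewrite {1}/shift_path -/w !(mulr_natl _ (nat_of_bool _)).
  by case: (p == m); case: (p == m + 1); case: (p == -m); case: (p == 1 - m);
    rewrite !(mulr0n, mulr1n) eq_complex /=; apply/andP; split; apply/eqP; ring.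
rewrite !zsumD !zsum_delta; try lia.
rewrite /shift_path -/w.
(* All comparisons are brought to six shared Booleans, so that [ring] can cancel the terms. *)
have -> : (m + 1 == l + 1) = (m == l) by lia.
have -> : (m + 1 == 1 - l) = (m == - l) by lia.
have -> : (- m == l) = (m == - l) by lia.
have -> : (- m == l + 1) = (m + 1 == - l) by lia.
have -> : (- m == - l) = (m == l) by lia.
have -> : (- m == 1 - l) = (m + 1 == l) by lia.
have -> : (1 - m == l) = (m == 1 - l) by lia.
have -> : (1 - m == l + 1) = (m == - l) by lia.
have -> : (1 - m == - l) = (m == l + 1) by lia.
have -> : (1 - m == 1 - l) = (m == l) by lia.
set b1 := (m == l); set b2 := (m == l + 1); set b3 := (m == - l).
set b4 := (m == 1 - l); set b5 := (m + 1 == l); set b6 := (m + 1 == - l).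
have -> : (b1%:R : C) = Complex b1%:R 0 by case: b1.
apply/eqP; rewrite eq_complex /=; apply/andP; split; apply/eqP; last by ring.
(* The real part is the Kronecker delta plus a multiple of [w * w - t * (1 - t)], which vanishes. *)
transitivity (b1%:R + (2 * b1%:R - b5%:R - b2%:R) * (w * w - t * (1 - t))).
  by ring.
by rewrite w2 mulr0 addr0.
Qed.

(** The same computation for a column, whose entries lie at [p], [p - 1], [-p] and [1 - p]. *)
Lemma shift_path_col t p q N : 0 <= t <= 1 -> (`|p| < N)%N ->
  zsum N (fun m => shift_path t m p * (shift_path t m q)^*) = (p == q)%:R.
Proof.
move=> /andP[t0 t1] pN.
set w := Num.sqrt (t * (1 - t)).
have w2 : w * w - t * (1 - t) = 0.
  by rewrite -expr2 sqr_sqrtr ?subrr // mulr_ge0 // subr_ge0.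
transitivity (zsum N (fun m => (m == p)%:R * ((1 - t)%:C%C * (shift_path t m q)^*) +
    ((m == p - 1)%:R * (t%:C%C * (shift_path t m q)^*) +
    ((m == - p)%:R * (Complex 0 w * (shift_path t m q)^*) +
     (m == 1 - p)%:R * (Complex 0 (- w) * (shift_path t m q)^*))))).
  apply: eq_zsum => m; rewrite !mulrA -!mulrDl; congr (_ * _).
  apply/eqP; rewrite {1}/shift_path -/w !(mulr_natl _ (nat_of_bool _)).
  have -> : (p == m) = (m == p) by lia.
  have -> : (p == m + 1) = (m == p - 1) by lia.
  have -> : (p == - m) = (m == - p) by lia.
  have -> : (p == 1 - m) = (m == 1 - p) by lia.
  by case: (m == p); case: (m == p - 1); case: (m == - p); case: (m == 1 - p);
    rewrite !(mulr0n, mulr1n) eq_complex /=; apply/andP; split; apply/eqP; ring.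
rewrite !zsumD !zsum_delta; try lia.
rewrite /shift_path -/w.
have -> : (q == p) = (p == q) by lia.
have -> : (q == p - 1) = (p == q + 1) by lia.
have -> : (q == p + 1) = (p + 1 == q) by lia.
have -> : (q == - p) = (p == - q) by lia.
have -> : (q == 1 - p) = (p == 1 - q) by lia.
have -> : (q == p - 1 + 1) = (p == q) by lia.
have -> : (q == - (p - 1)) = (p == 1 - q) by lia.
have -> : (q == 1 - (p - 1)) = (p == 2 - q) by lia.
have -> : (q == - p + 1) = (p == 1 - q) by lia.
have -> : (q == - - p) = (p == q) by lia.
have -> : (q == 1 - - p) = (p + 1 == q) by lia.
have -> : (q == 1 - p + 1) = (p == 2 - q) by lia.
have -> : (q == - (1 - p)) = (p == q + 1) by lia.
have -> : (q == 1 - (1 - p)) = (p == q) by lia.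
set b1 := (p == q); set b2 := (p == q + 1); set b3 := (p == - q).
set b4 := (p == 1 - q); set b5 := (p + 1 == q); set b6 := (p == 2 - q).
have -> : (b1%:R : C) = Complex b1%:R 0 by case: b1.
apply/eqP; rewrite eq_complex /=; apply/andP; split; apply/eqP; last by ring.
transitivity (b1%:R + (2 * b1%:R - b5%:R - b2%:R) * (w * w - t * (1 - t))).
  by ring.
by rewrite w2 mulr0 addr0.
Qed.

Definition tent (x : R) : R := Num.max 0 (1 - `|x|).

(* [Num.sqrt] vanishes on negative numbers, so [hump] is supported in [0, 1]. *)
Definition hump (x : R) : R := Num.sqrt (x * (1 - x)).

(** Row [m] of the path glued over all unit intervals: a real tent centred at [-m] and two opposite
    imaginary humps on either side of [m]. *)
Definition shift_fun m (x : R) : C :=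
  Complex (tent (x + m%:~R)) (hump (x - m%:~R) - hump (x - m%:~R + 1)).

Lemma hump_out (x : R) : (x <= 0) || (1 <= x) -> hump x = 0.
Proof.
move=> xo; apply/ler0_sqrtr; case/orP: xo => x0.
  by rewrite mulr_le0_ge0 // subr_ge0 (le_trans x0).
by rewrite mulr_ge0_le0 ?subr_le0 // (le_trans _ x0).
Qed.

Lemma hump_shift t k : 0 <= t <= 1 ->
  hump (t - k%:~R) = hump t * (k == 0)%:R.
Proof.
move=> t01; have [->|k0] := eqVneq k 0; first by rewrite subr0 mulr1.
rewrite mulr0 hump_out //; have [k1|k1] : (k <= -1) \/ (1 <= k) by lia.
- have : k%:~R <= (-1)%:~R :> R by rewrite ler_int.
  by rewrite mulrN1z => ?; apply/orP; right; lra.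
- have : 1%:~R <= k%:~R :> R by rewrite ler_int.
  by rewrite mulr1z => ?; apply/orP; left; lra.
Qed.

(* At [t = 1] row [m] of the path is row [m] at [t = 0] shifted by one, which is
   why these rows glue to one continuous function of [t - p]. *)
Lemma shift_funE t m p : 0 <= t <= 1 ->
  shift_fun m (t - p%:~R) = shift_path t m p.
Proof.
move=> t01; rewrite /shift_fun /shift_path; congr Complex.
  have -> : t - p%:~R + m%:~R = t - (p - m)%:~R by rewrite intrB; ring.
  have -> : (p == m) = (p - m == 0) by lia.
  have -> : (p == m + 1) = (p - m == 1) by lia.
  move: (p - m) => k; rewrite /tent.
  have [->|k0] := eqVneq k 0.
    rewrite subr0 /= mulr1 mulr0 addr0 ger0_norm ?max_r //; lra.
  have [->|k1] := eqVneq k 1.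
    rewrite /= mulr0 mulr1 add0r mulr1z ler0_norm ?max_r //; lra.
  rewrite /= !mulr0 addr0 max_l // subr_le0.
  have [k2|k2] : (k <= -1) \/ (2 <= k) by lia.
  - have : k%:~R <= (-1)%:~R :> R by rewrite ler_int.
    rewrite mulrN1z => ?; rewrite ger0_norm; lra.
  - have : 2%:~R <= k%:~R :> R by rewrite ler_int.
    move=> ?; rewrite ler0_norm; lra.
have -> : t - p%:~R - m%:~R = t - (p + m)%:~R by rewrite intrD; ring.
have -> : t - (p + m)%:~R + 1 = t - (p + m - 1)%:~R by rewrite intrB; ring.
rewrite !hump_shift // -mulrBr; congr (_ * (_%:R - _%:R)); congr nat_of_bool; lia.
Qed.

(** The tent sits near [-m] and the humps near [m], so the support is located only up to sign. *)
Lemma shift_fun_supp m (x : R) : shift_fun m x != 0 ->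
  `| `|x| - (absz m)%:R | <= 2.
Proof.
have -> : (absz m)%:R = `|m%:~R| :> R by rewrite -intr_norm -abszE.
apply: contraR; rewrite -ltNge /shift_fun; move: (m%:~R : R) => y xy.
have y1 : 2 < `|x + y|.
  by apply: lt_le_trans xy _; have := ler_dist_dist x (- y); rewrite normrN opprK.
have y2 : 2 < `|x - y| by apply: lt_le_trans xy _; exact: ler_dist_dist.
rewrite eq_complex /=; apply/andP; split; apply/eqP.
  by apply/max_l; rewrite subr_le0; lra.
by move: y2; rewrite ltr_normr => /orP[] ?; rewrite !hump_out ?subrr //; lra.
Qed.

End BilateralShift.

(** * Boxes in Z^n and the tensor product basis *)

Section Box.
Local Open Scope fset_scope.
Variable n : nat.
Local Notation Zn := 'rV[int]_n.

Definition box_pt N (f : {ffun 'I_n -> 'I_((2 * N).+1)}) : Zn :=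
  \row_i ((f i)%:Z - N%:Z).

Definition box N : {fset Zn} :=
  [fset box_pt f | f in {ffun 'I_n -> 'I_((2 * N).+1)}].

Lemma box_pt_inj N : injective (@box_pt N).
Proof.
move=> f g /rowP fg; apply/ffunP => i; apply/val_inj.
by have := fg i; rewrite !mxE /=; lia.
Qed.

Lemma mem_box N (p : Zn) : (p \in box N) = [forall i, (absz (p ord0 i) <= N)%N].
Proof.
apply/imfsetP/forallP => [[f _ ->] i|pN].
  rewrite mxE; move: (nat_of_ord _) (ltn_ord (f i)) => k; lia.
have lt i : (absz (p ord0 i + N%:Z)%R < (2 * N).+1)%N by have := pN i; lia.
exists [ffun i => Ordinal (lt i)] => //.
by apply/rowP => i; rewrite !mxE ffunE /=; have := pN i; rewrite [ord0]ord1 => ?; lia.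
Qed.

Lemma big_box_prod (R : rcfType) N (F : 'I_n -> int -> R[i]) :
  \sum_(p <- box N) \prod_i F i (p ord0 i) = \prod_i zsum N (F i).
Proof.
rewrite /box big_imfset /=; last by move=> f g _ _; exact: box_pt_inj.
rewrite /zsum bigA_distr_bigA /= big_enum_cond /=.
by apply: eq_bigr => f _; apply: eq_bigr => i _; rewrite mxE.
Qed.

Definition znorm (p : Zn) : nat := (\sum_i absz (p ord0 i))%N.

Lemma le_znorm (p : Zn) (i : 'I_n) : (absz (p ord0 i) <= znorm p)%N.
Proof. by rewrite /znorm (bigD1 i) //= leq_addr. Qed.

Lemma fset_sub_box (A : {fset Zn}) : exists N, A `<=` box N.
Proof.
exists (\max_(p <- A) znorm p)%N; apply/fsubsetP => p pA.
rewrite mem_box; apply/forallP => i; apply: leq_trans (le_znorm p i) _.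
exact: leq_bigmax_seq.
Qed.

End Box.

Section ProductBasis.
Local Open Scope fset_scope.
Variables (R : realType) (n : nat).
Local Notation C := R[i].
Local Notation Rn := 'rV[R]_n.
Local Notation Zn := 'rV[int]_n.

Definition lattice_fun (m : Zn) (x : Rn) : C :=
  \prod_i shift_fun (m ord0 i) (x ord0 i).

Lemma prodr_delta (m l : Zn) :
  \prod_i (m ord0 i == l ord0 i)%:R = (m == l)%:R :> C.
Proof.
have [->|ml] := eqVneq m l; first by rewrite big1 // => i _; rewrite eqxx.
have [i mi] : exists i, m ord0 i != l ord0 i.
  apply/existsP; rewrite -negb_forall; apply: contra ml => /forallP h.
  by apply/eqP/rowP => i; exact/eqP.
by rewrite (bigD1 i) //= (negPf mi) mul0r.
Qed.

Lemma lattice_fun_translate (m p : Zn) (t : Rn) : cube t ->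
  lattice_fun m (translate p t) =
  \prod_i shift_path (t ord0 i) (m ord0 i) (p ord0 i).
Proof.
move=> tc; apply: eq_bigr => i _.
by rewrite !mxE shift_funE //; exact: tc.
Qed.

(** The orthogonality sums factor over the coordinates into those of [shift_path]. A nonzero entry
    makes [m] and [p] differ by at most one in absolute value in each coordinate, hence the radii
    [(znorm m).+1], which do not depend on [t]. *)
Lemma lattice_unitary (t : Rn) : cube t ->
  finitary_unitary (fun m p => lattice_fun m (translate p t))
    (fun m => box n (znorm m).+1) (fun p => box n (znorm p).+1).
Proof.
move=> tc.
have supp m p : lattice_fun m (translate p t) != 0 -> forall i,
    shift_path (t ord0 i) (m ord0 i) (p ord0 i) != 0.
  rewrite lattice_fun_translate // => h i; apply: contraNneq h => h.
  by rewrite (bigD1 i) //= h mul0r.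
have band (s : R) (a b : int) : shift_path s a b != 0 ->
    (absz a <= (absz b).+1)%N /\ (absz b <= (absz a).+1)%N.
  move=> h; suff : [|| b == a, b == a + 1, b == - a | b == 1 - a]%R by lia.
  apply: contraNT h; rewrite !negb_or /shift_path => /and4P[].
  do 4 move=> /negPf ->.
  by rewrite !mulr0 addr0 subrr mulr0.
split.
- move=> m p /supp h; rewrite mem_box; apply/forallP => i.
  by have [_ /leq_trans] := band _ _ _ (h i); apply; rewrite ltnS le_znorm.
- move=> m p /supp h; rewrite mem_box; apply/forallP => i.
  by have [/leq_trans + _] := band _ _ _ (h i); apply; rewrite ltnS le_znorm.
- move=> m l; under eq_bigr => p _ do
    rewrite !lattice_fun_translate // rmorph_prod -big_split /=.
  rewrite (big_box_prod _ (fun i p => (shift_path (t ord0 i) (m ord0 i) p)^* *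
    shift_path (t ord0 i) (l ord0 i) p)) -prodr_delta.
  by apply: eq_bigr => i _; rewrite shift_path_row ?tc // ltnS le_znorm.
- move=> p q; under eq_bigr => m _ do
    rewrite !lattice_fun_translate // rmorph_prod -big_split /=.
  rewrite (big_box_prod _ (fun i m => shift_path (t ord0 i) m (p ord0 i) *
    (shift_path (t ord0 i) m (q ord0 i))^*)) -prodr_delta.
  by apply: eq_bigr => i _; rewrite shift_path_col ?tc // ltnS le_znorm.
Qed.

End ProductBasis.

Lemma finitary_unitary_reindex (C : numClosedFieldType) (I J K : choiceType)
    (G : J -> I -> C) rs cs (e : K -> J) (d : J -> K) :
  cancel e d -> cancel d e -> finitary_unitary G rs cs ->
  finitary_unitary (G \o e) (rs \o e) (fun p => [fset d m | m in cs p])%fset.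
Proof.
move=> ed de [Grs Gcs Go Gc]; split => /=.
- by move=> k p /Grs.
- by move=> k p /Gcs kp; apply/imfsetP; exists (e k).
- by move=> k l; rewrite Go (can_eq ed).
- move=> p q; rewrite big_imfset /=; last by move=> ? ? _ _; exact: (can_inj de).
  by under eq_bigr => m _ do rewrite de; exact: Gc.
Qed.

(** * Uniform limits of complex functions *)

Section ComplexLimits.

(** Uniform neighbourhoods are generated by balls; halving [e] turns the non-strict bound into the
    strict one of a ball. *)
Lemma uniform_cvgP (K : numFieldType) (V : pseudoMetricNormedZmodType K)
    (X : choiceType) (T : Type) (F : set_system T) (u : T -> X -> V) (A : set X) h :
  Filter F ->
  {uniform A, u @ F --> h} <->
  forall e : K, 0 < e -> \forall k \near F, forall t, A t -> `|u k t - h t| <= e.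
Proof.
move=> FF; split => [uh e e0|uh P /uniform_nbhs[E [entE EP]]].
  apply: (uh [set g | forall t, A t -> `|g t - h t| <= e]).
  apply/uniform_nbhs; exists [set xy | ball xy.1 e xy.2]; split.
    by rewrite -entourage_from_ballE; exists e.
  move=> g /= gh t At; have := gh t At.
  by rewrite -ball_normE /= distrC; exact: ltW.
have [e /= e0 eE] : exists2 e : K, 0 < e & [set xy | ball xy.1 e xy.2] `<=` E.
  by move: entE; rewrite -entourage_from_ballE => -[e e0 eE]; exists e.
have e20 : 0 < e / 2 by rewrite divr_gt0.
apply: filterS (uh _ e20) => k ukh; apply: EP => t At; apply: eE => /=.
rewrite -ball_normE /= distrC; apply: le_lt_trans (ukh t At) _.
by rewrite ltr_pdivrMr // ltr_pMr // ltr1n.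
Qed.

Variable R : realType.
Local Notation C := R[i].

Lemma complex_gt0P (e : C) : 0 < e -> exists2 r : R, 0 < r & e = r%:C%C.
Proof.
rewrite ltcE /= => /andP[/eqP ie re]; exists (complex.Re e) => //.
by case: e ie {re} => a b /= ->.
Qed.

(** Real and imaginary parts are Cauchy in the complete field [R]; errors of [r / 2] in both give a
    modulus below [r]. *)
Lemma complex_cauchy_lim (T : Type) (F : set_system T) (u : T -> C) :
  ProperFilter F ->
  (forall e : C, 0 < e -> exists2 P, F P & forall a b, P a -> P b -> `|u a - u b| <= e) ->
  exists l, forall e : C, 0 < e -> \forall a \near F, `|u a - l| <= e.
Proof.
move=> FF ucauchy.
have part (r : C -> R) : (forall z w, r (z - w) = r z - r w) ->
    (forall z, (`|r z|)%:C%C <= `|z|) -> cvg (r \o u @ F).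
  move=> rB rle; apply/cauchy_cvgP; apply/cauchy_exP => e e0.
  have e2 : (0 : C) < (e / 2)%:C%C by rewrite ltcR divr_gt0.
  have [P FP Pu] := ucauchy _ e2.
  have [a Pa] := filter_ex FP; exists (r (u a)).
  rewrite -ball_normE; change (F [set b | `|r (u a) - r (u b)| < e]).
  apply: filterS FP => b Pb /=; rewrite -rB.
  have := le_trans (rle (u a - u b)) (Pu _ _ Pa Pb); rewrite lecR => /le_lt_trans; apply.
  by rewrite ltr_pdivrMr // ltr_pMr // ltr1n.
have Rle (z : C) : (`|complex.Re z|)%:C%C <= `|z|.
  rewrite normc_def lecR -sqrtr_sqr ler_sqrt ?lerDl ?sqr_ge0 //.
  by rewrite addr_ge0 ?sqr_ge0.
have Ile (z : C) : (`|complex.Im z|)%:C%C <= `|z|.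
  rewrite normc_def lecR -sqrtr_sqr ler_sqrt ?lerDr ?sqr_ge0 //.
  by rewrite addr_ge0 ?sqr_ge0.
have cR : cvg (@complex.Re R \o u @ F) by apply: part => // -[? ?] [].
have cI : cvg (@complex.Im R \o u @ F) by apply: part => // -[? ?] [].
exists (Complex (lim (@complex.Re R \o u @ F)) (lim (@complex.Im R \o u @ F))) => e e0.
have [r r0 ->] := complex_gt0P e0.
have r2 : 0 < r / 2 by rewrite divr_gt0.
have /cvgr_dist_le/(_ _ r2) nR := cR.
have /cvgr_dist_le/(_ _ r2) nI := cI.
near=> a.
have hR : `|lim (@complex.Re R \o u @ F) - complex.Re (u a)| <= r / 2 by near: a.
have hI : `|lim (@complex.Im R \o u @ F) - complex.Im (u a)| <= r / 2 by near: a.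
move: hR hI; case: (u a) => x y /=; set p := lim _; set q := lim _.
move=> hR hI; rewrite normc_def /= lecR.
rewrite -[leRHS](ger0_norm (ltW r0)) -[leRHS]sqrtr_sqr ler_sqrt ?sqr_ge0 //.
move: hR hI; rewrite !ler_norml => /andP[? ?] /andP[? ?]; nra.
Unshelve. all: by end_near. Qed.

End ComplexLimits.

(** * Existence of limits of pairings, and sums indexed by the natural numbers *)

Section UniformSquareSumExistence.
Local Open Scope fset_scope.

Lemma big_fset_subD (V : zmodType) (I : choiceType) (A0 A : {fset I}) (F : I -> V) :
  A0 `<=` A ->
  \sum_(p <- A) F p = (\sum_(p <- A0) F p + \sum_(p <- A `\` A0) F p)%R.
Proof.
move=> /fsubsetP sA; rewrite (big_fsetID _ (mem A0)) /=.
have -> : [fset p in A | p \in A0] = A0.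
  by apply/fsetP => p; rewrite !inE /= andb_idl // => /sA.
by have -> : [fset p in A | p \notin A0] = A `\` A0
  by apply/fsetP => p; rewrite !inE /= andbC.
Qed.

Lemma ler_sum_fsub (K : numDomainType) (I : choiceType) (A B : {fset I}) (F : I -> K) :
  A `<=` B -> (forall p, 0 <= F p) -> \sum_(p <- A) F p <= \sum_(p <- B) F p.
Proof.
by move=> sAB F0; rewrite (big_fset_subD F sAB) lerDl sumr_ge0.
Qed.

(** Beyond a finite set the square sums are at most 1, and each of the remaining finitely many terms
    is bounded on [D]. *)
Lemma sqsum_tail_bounded (C : numClosedFieldType) (X : Type) (D : set X)
    (I : choiceType) (f : X -> I -> C) :
  sqsum_tail D f ->
  (forall p, exists2 K, 0 <= K & forall x, D x -> `|f x p| ^+ 2 <= K) ->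
  sqsum_bounded D f.
Proof.
move=> ft fK; have [A0 A0P] := ft 1 ltr01.
have /choice[K KP] : forall p, exists K, 0 <= K /\ forall x, D x -> `|f x p| ^+ 2 <= K.
  by move=> p; have [K K0 KP] := fK p; exists K.
have K0 : 0 <= \sum_(p <- A0) K p by apply: sumr_ge0 => p _; have [] := KP p.
exists (\sum_(p <- A0) K p + 1)%R; first by rewrite ltr_wpDl.
move=> B x Dx; apply: le_trans (_ : \sum_(p <- A0 `|` B) `|f x p| ^+ 2 <= _).
  by apply: ler_sum_fsub => [|p]; rewrite ?fsubsetUr ?exprn_ge0.
rewrite (big_fset_subD _ (fsubsetUl A0 B)); apply: lerD; last exact: A0P.
by apply: ler_sum => p _; have [_] := KP p; exact.
Qed.

Lemma dot_cvg_exists (R : realType) (X : Type) (D : set X) (I : choiceType)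
    (f g : X -> I -> R[i]) :
  sqsum_tail D f -> sqsum_bounded D g -> exists h, dot_cvg D f g h.
Proof.
move=> ft gb; pose S x (A : {fset I}) := \sum_(p <- A) (f x p)^* * g x p.
have cauchy (e : R[i]) : 0 < e -> exists A0 : {fset I}, forall A B : {fset I}, forall x,
    A0 `<=` A -> A0 `<=` B -> D x -> `|S x A - S x B| <= e.
  move=> e0; have e20 : 0 < e / 2 by rewrite divr_gt0.
  have [A0 A0P] := tail_dot_cauchy ft gb e20; exists A0 => A B x sA sB Dx.
  rewrite /S (big_fset_subD _ sA) (big_fset_subD _ sB) opprD addrACA subrr add0r.
  rewrite [leRHS]splitr; apply: le_trans (ler_normB _ _) (lerD _ _); exact: A0P.
have /choice[h hP] : forall x, exists l, D x ->
    forall e : R[i], 0 < e -> \forall A \near totally, `|S x A - l| <= e.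
  move=> x; have [Dx|nDx] := pselect (D x); last by exists 0.
  have [|l lP] := @complex_cauchy_lim R _ _ (S x) totally_filter; last by exists l.
  move=> e e0; have [A0 A0P] := cauchy e e0.
  exists (fun A : {fset I} => A0 `<=` A); first by exists A0.
  by move=> A B sA sB; exact: A0P.
exists h => e e0; have e20 : 0 < e / 2 by rewrite divr_gt0.
have [A0 A0P] := cauchy _ e20; exists A0 => A sA x Dx.
have [A1 _ A1P] := hP x Dx _ e20.
(* Here [A1] depends on [x] but [A0] does not: passing through their union turns the pointwise limit
   into a uniform one. *)
rewrite [leRHS]splitr; apply: le_trans (ler_distD (S x (A0 `|` A1)) _ _) (lerD _ _).
  by apply: A0P => //; exact: fsubsetUl.
by apply: A1P; exact: fsubsetUr.
Qed.

Definition fset_iota N : {fset nat} := [fset j | j in iota 0 N].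

Lemma mem_fset_iota N j : (j \in fset_iota N) = (j < N)%N.
Proof. by rewrite inE /= mem_iota. Qed.

Lemma big_fset_iota (V : nmodType) N (F : nat -> V) :
  \sum_(j <- fset_iota N) F j = \sum_(j < N) F j.
Proof.
have -> : \sum_(j < N) F j = \sum_(j <- iota 0 N) F j.
  by rewrite -(big_mkord xpredT) /index_iota subn0.
apply: perm_big; apply: uniq_perm; rewrite ?fset_uniq ?iota_uniq // => j.
by rewrite mem_fset_iota mem_iota.
Qed.

Lemma fset_sub_iota (A : {fset nat}) : exists N, A `<=` fset_iota N.
Proof.
exists (\max_(j <- A) j).+1; apply/fsubsetP => j jA.
by rewrite mem_fset_iota ltnS; apply: leq_bigmax_seq.
Qed.

Lemma fset_iota_sub N M : (N <= M)%N -> fset_iota N `<=` fset_iota M.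
Proof.
move=> NM; apply/fsubsetP => j; rewrite !mem_fset_iota => /leq_trans; exact.
Qed.

Lemma dot_cvg_nat (C : numClosedFieldType) (X : Type) (D : set X)
    (f g : X -> nat -> C) h : dot_cvg D f g h ->
  forall e : C, 0 < e -> \forall N \near \oo, forall x, D x ->
    `|\sum_(j < N) (f x j)^* * g x j - h x| <= e.
Proof.
move=> fgh e e0; have [A0 A0P] := fgh e e0; have [N0 sN0] := fset_sub_iota A0.
exists N0 => // N /= N0N x Dx.
rewrite -(big_fset_iota N (fun j => (f x j)^* * g x j)); apply: A0P => //.
exact: fsubset_trans sN0 (fset_iota_sub N0N).
Qed.

(** Squares are nonnegative, so an arbitrary finite set may be enlarged to an initial segment;
    ordered convergence thus controls unordered tails. *)
Lemma nat_cvg_tail (C : numClosedFieldType) (X : Type) (D : set X)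
    (f : X -> nat -> C) h :
  (forall e : C, 0 < e -> \forall N \near \oo, forall x, D x ->
    `|\sum_(j < N) `|f x j| ^+ 2 - h x| <= e) -> sqsum_tail D f.
Proof.
move=> fh e e0; have e20 : 0 < e / 2 by rewrite divr_gt0.
have [N0 _ N0P] := fh _ e20; exists (fset_iota N0) => B x Dx.
have [N1 sN1] := fset_sub_iota B; pose N := maxn N0 N1.
apply: le_trans (_ : \sum_(j <- fset_iota N `\` fset_iota N0) `|f x j| ^+ 2 <= _).
  apply: ler_sum_fsub => [|p]; last by rewrite exprn_ge0.
  apply: fsetSD; apply: fsubset_trans sN1 (fset_iota_sub _); exact: leq_maxr.
have sN : fset_iota N0 `<=` fset_iota N by apply: fset_iota_sub; exact: leq_maxl.
have E := big_fset_subD (fun j => `|f x j| ^+ 2) sN.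
set s := \sum_(_ <- _ `\` _) _ in E *.
have s0 : 0 <= s by apply: sumr_ge0 => j _; rewrite exprn_ge0.
rewrite -(ger0_norm s0).
have -> : s = (\sum_(j < N) `|f x j| ^+ 2 - \sum_(j < N0) `|f x j| ^+ 2)%R.
  rewrite -!(big_fset_iota _ (fun j => `|f x j| ^+ 2)).
  by rewrite E addrAC subrr add0r.
rewrite [leRHS]splitr; apply: le_trans (ler_distD (h x) _ _) (lerD _ _).
  by apply: N0P => //=; exact: leq_maxl.
by rewrite distrC; apply: N0P => /=.
Qed.

End UniformSquareSumExistence.

(** * Continuity of complex-valued functions *)

Section ComplexContinuity.
Variables (R : realType) (T : topologicalType).
Local Notation C := R[i].

Lemma conjC_continuous : continuous (Num.conj : C -> C).
Proof.
move=> z; apply/(@cvgrPdist_le _ C _ _ (nbhs_filter z)) => e e0; near=> w.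
by rewrite -rmorphB norm_conjC; near: w; apply: cvgr_dist_le.
Unshelve. all: by end_near. Qed.

Lemma complex_continuous (f g : T -> R) : continuous f -> continuous g ->
  continuous (fun x => Complex (f x) (g x) : C).
Proof.
move=> fc gc x; apply/cvgrPdist_le => e e0.
have [r r0 ->] := complex_gt0P e0.
have r2 : 0 < r / 2 by rewrite divr_gt0.
near=> y.
have hf : `|f x - f y| <= r / 2 by near: y; exact: cvgr_dist_le (fc x) _ r2.
have hg : `|g x - g y| <= r / 2 by near: y; exact: cvgr_dist_le (gc x) _ r2.
rewrite normc_def /= lecR.
rewrite -[leRHS](ger0_norm (ltW r0)) -[leRHS]sqrtr_sqr ler_sqrt ?sqr_ge0 //.
move: hf hg; rewrite !ler_norml => /andP[? ?] /andP[? ?]; nra.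
Unshelve. all: by end_near. Qed.

Lemma sum_continuous (I : Type) (s : seq I) (F : I -> T -> C) :
  (forall i, continuous (F i)) -> continuous (fun x => \sum_(i <- s) F i x).
Proof.
by move=> Fc; apply: continuous_big => // -[x y]; exact: add_continuous.
Qed.

Lemma prod_continuous (I : Type) (s : seq I) (F : I -> T -> C) :
  (forall i, continuous (F i)) -> continuous (fun x => \prod_(i <- s) F i x).
Proof.
move=> Fc; apply: continuous_big => // -[x y]; exact: mul_continuous.
Qed.

Lemma mulC_continuous (f g : T -> C) : continuous f -> continuous g ->
  continuous (fun x => f x * g x).
Proof. by move=> fc gc x; apply: continuousM; [exact: fc|exact: gc]. Qed.

End ComplexContinuity.

(** * Translates, the unit cube and the module Xi *)

Section Lattice.
Variables (R : realType) (n : nat).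
Local Notation C := R[i].
Local Notation Rn := 'rV[R]_n.
Local Notation Zn := 'rV[int]_n.

Lemma translateD p q (t : Rn) : translate p (translate q t) = translate (p + q) t.
Proof. by rewrite /translate map_mxD opprD addrA addrAC. Qed.

Lemma translate0 (t : Rn) : translate 0 t = t.
Proof. by rewrite /translate map_mx0 subr0. Qed.

Lemma translate_continuous p : continuous (@translate R n p).
Proof.
move=> t; apply/(@cvgrPdist_le R Rn _ _ (nbhs_filter t)) => e e0; near=> s.
have -> : translate p t - translate p s = t - s.
  by rewrite /translate opprB addrA subrK.
 near: s; exact: cvgr_dist_le.
Unshelve. all: by end_near. Qed.

Definition int_part (t : Rn) : Zn := \row_i Num.floor (t ord0 i).

Definition frac_part (t : Rn) : Rn := translate (int_part t) t.

Lemma frac_part_cube t : cube (frac_part t).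
Proof.
move=> i; rewrite !mxE [ord0]ord1 subr_ge0 floor_le /= lerBlDl.
by have /ltW := floorD1_gt (t 0 i); rewrite intrD.
Qed.

Lemma frac_part_translate p t : frac_part (translate p t) = frac_part t.
Proof.
apply/rowP => i; rewrite !mxE [ord0]ord1.
have -> : Num.floor (t 0 i - (p 0 i)%:~R) = Num.floor (t 0 i) - p 0 i.
  apply: floor_def; have /andP[] := floor_itv (t 0 i).
  by rewrite !intrD !intrN => ? ?; apply/andP; split; lra.
by rewrite intrB; lra.
Qed.

Definition lattice_periodic (f : Rn -> C) := forall p t, f (translate p t) = f t.

Lemma lattice_periodic_frac f t : lattice_periodic f -> f (frac_part t) = f t.
Proof. by move=> fp; exact: fp. Qed.

Lemma shift_fun_continuous (m : int) : continuous (@shift_fun R m).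
Proof.
have addc (a : R) : continuous (fun x : R => x + a).
  by move=> x; apply: cvgD; [exact: cvg_id|exact: cvg_cst].
have humpc : continuous (@hump R).
  move=> x; apply: continuous_comp; last exact: sqrt_continuous.
  by apply: continuousM => //; apply: cvgB; [exact: cvg_cst|exact: cvg_id].
have humpDc (a : R) : continuous (fun x : R => hump (x + a)).
  move=> x; apply: (@continuous_comp _ _ _ (fun x => x + a)); first exact: addc.
  exact: humpc.
apply: complex_continuous => x.
  apply: (@continuous_max R R (cst 0) (fun x => 1 - `|x + m%:~R|) x).
    exact: cst_continuous.
  apply: (@cvgB R R R (nbhs x) _ (cst 1) (fun x => `|x + m%:~R|)).
    exact: cst_continuous.
  by apply: cvg_norm; exact: addc.
apply: (@cvgB R R R (nbhs x) _ (fun x => hump (x - m%:~R))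
  (fun x => hump (x - m%:~R + 1))).
  exact: (humpDc (- m%:~R)).
under eq_fun do rewrite -addrA; rewrite -addrA; exact: humpDc.
Qed.

Lemma lattice_fun_continuous (m : Zn) : continuous (@lattice_fun R n m).
Proof.
apply: prod_continuous => i x.
by apply: continuous_comp; [exact: coord_continuous|exact: shift_fun_continuous].
Qed.

Lemma continuous_bounded_cube (F : Rn -> C) : continuous F ->
  exists2 K : C, 0 <= K & forall x, cube x -> `|F x| <= K.
Proof.
move=> Fc; pose r (x : Rn) : R := complex.Re `|F x|.
have rE x : (r x)%:C%C = `|F x| by rewrite /r normc_def.
have rc : continuous r.
  move=> x; apply/(@cvgrPdist_le R R _ _ (nbhs_filter x)) => e e0.
  have e0' : (0 : C) < e%:C%C by rewrite ltcR.
  have /cvgr_dist_le/(_ _ e0') := Fc x; apply: filterS => y h.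
  rewrite -lecR; apply: le_trans h; apply: le_trans (ler_dist_dist _ _).
  by rewrite -!rE -rmorphB normc_def /= expr0n addr0 sqrtr_sqr.
have : compact (r @` @cube R n).
  apply: continuous_compact; first exact: continuous_subspaceT.
  apply: (rV_compact (A := fun=> [set x : R | 0 <= x <= 1])) => i.
  have -> : [set x : R | 0 <= x <= 1] = `[0, 1]%classic.
    by apply/seteqP; split => x /=; rewrite in_itv.
  exact: segment_compact.
move=> /compact_bounded[M [_ MP]].
have M0 : M < Num.max 0 M + 1 by rewrite ltr_pwDr // le_max lexx orbT.
exists (Num.max 0 M + 1)%:C%C.
  by rewrite ler0c addr_ge0 // le_max lexx.
move=> x xc; rewrite -rE lecR; apply: le_trans (ler_norm _) _.
by apply: (MP _ M0); exists x.
Qed.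

(** A natural number bounds all coordinates, so that the translates of a cube point meeting the
    support lie in an explicit [box]. *)
Definition bounded_support (f : Rn -> C) : Prop :=
  exists K : nat, forall x, f x != 0 -> forall i, `|x ord0 i| <= K%:R.

Lemma cube_translate_box (t : Rn) (p : Zn) (K : nat) : cube t ->
  (forall i, `|translate p t ord0 i| <= K%:R) -> p \in box n K.+1.
Proof.
move=> tc h; rewrite mem_box; apply/forallP => i; have := h i; have := tc i.
rewrite !mxE [ord0]ord1 => /andP[t0 t1]; rewrite ler_norml => /andP[h1 h2].
have h3 : (p 0 i)%:~R <= (Posz K.+1)%:~R :> R by rewrite -pmulrn -natr1; lra.
have h4 : (- Posz K.+1)%:~R <= (p 0 i)%:~R :> R.
  by rewrite intrN -pmulrn -natr1; lra.
by move: h3 h4; rewrite !ler_int; lia.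
Qed.

Lemma le_mx_norm_coord (t : Rn) i : `|t ord0 i| <= `|t|.
Proof.
rewrite /Num.norm /= mx_normrE.
exact: (le_bigmax _ (fun ij => `|t ij.1 ij.2|) (ord0, i)).
Qed.

End Lattice.

(** * The completion of C_c(R^n) as continuous functions with uniformly small tails *)

Section CompletionOfCc.
Variables (R : realType) (n : nat).
Local Notation C := R[i].
Local Notation Rn := 'rV[R]_n.
Local Notation Zn := 'rV[int]_n.
Implicit Types (f g xi eta Phi Psi : Rn -> C).

Definition fibre f (t : Rn) (p : Zn) : C := f (translate p t).

Lemma Cc_bounded_support f : Cc f -> bounded_support f.
Proof.
move=> [_ /compact_bounded[M [_ MP]]].
pose K := Num.bound (Num.max 0 M).
have MK : M < K%:R.
  apply: le_lt_trans (archi_boundP _); last by rewrite le_max lexx.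
  by rewrite le_max lexx orbT.
exists K => x fx i; apply: le_trans (le_mx_norm_coord x i) _.
by apply: (MP _ MK); apply: subset_closure.
Qed.

Lemma bounded_support_Cc f : continuous f -> bounded_support f -> Cc f.
Proof.
move=> fc [K fK]; split=> //.
pose B := [set x : Rn | forall i, `[- K%:R, K%:R]%classic (x ord0 i)].
have Bc : compact B.
  apply: (rV_compact (A := fun=> `[- K%:R, K%:R]%classic : set R)) => i.
  exact: segment_compact.
apply: (subclosed_compact _ Bc); first exact: closed_closure.
have Bcl : closed B by apply: compact_closed => //; exact: norm_hausdorff.
rewrite closureE => x; apply; split=> // y /= fy i.
change (is_true (y ord0 i \in `[- K%:R, K%:R])).
by rewrite in_itv /= -ler_norml; exact: fK.
Qed.

(** The support of [f] alone cuts the sum down, so [g] is arbitrary; this lets [zcoef] pair a basis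
    function with any function. *)
Lemma Cc_dot_fset f g (K : nat) (t : Rn) (A : {fset Zn}) :
  (forall x, f x != 0 -> forall i, `|x ord0 i| <= K%:R) -> cube t ->
  (box n K.+1 `<=` A)%fset ->
  Cc_dot f g t = \sum_(p <- A) (fibre f t p)^* * fibre g t p.
Proof.
move=> fK tc /fsubsetP sA; apply: fsbigTE => p pA.
have [->|h] := eqVneq (f (translate p t)) 0; first by rewrite conjC0 mul0r.
by case/negP: pA; apply: sA; apply: cube_translate_box tc _; exact: fK.
Qed.

Lemma Cc_dot_periodic f g : lattice_periodic (Cc_dot f g).
Proof.
move=> q t; rewrite /Cc_dot (@reindex_fsbigT _ _ _ _ _ (fun p => p - q)).
  by apply: eq_fsbigr => p _; rewrite translateD subrK.
by exists (fun p => p + q) => p; rewrite ?subrK ?addrK.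
Qed.

Lemma fibre_continuous f p : continuous f -> continuous (fibre f ^~ p).
Proof.
by move=> fc t; apply: continuous_comp; [exact: translate_continuous|exact: fc].
Qed.

Lemma fset_dot_continuous f g (A : {fset Zn}) : continuous f -> continuous g ->
  continuous (fun t => \sum_(p <- A) (fibre f t p)^* * fibre g t p).
Proof.
move=> fc gc; apply: sum_continuous => p; apply: mulC_continuous.
  move=> t; apply: continuous_comp; first exact: fibre_continuous.
  exact: conjC_continuous.
exact: fibre_continuous.
Qed.

Lemma sum_sqr_norm (I : choiceType) (A : {fset I}) (x : I -> C) :
  \sum_(p <- A) `|x p| ^+ 2 = \sum_(p <- A) (x p)^* * x p.
Proof. by apply: eq_bigr => p _; rewrite normCK mulrC. Qed.

(** Periodicity reduces the supremum to the cube, where the inner product is a fixed finite sum of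
    squares; the lemma removes [sup] and the square root from later estimates. *)
Lemma Cc_norm_leP f (e : R) : 0 <= e -> Cc f ->
  Cc_norm f <= e <-> forall (A : {fset Zn}) t, cube t ->
    \sum_(p <- A) `|fibre f t p| ^+ 2 <= (e ^+ 2)%:C%C.
Proof.
move=> e0 Cf; have [K fK] := Cc_bounded_support Cf; have [fc _] := Cf.
have dotE t : cube t -> Cc_dot f f t = \sum_(p <- box n K.+1) `|fibre f t p| ^+ 2.
  by move=> tc; rewrite sum_sqr_norm; apply: Cc_dot_fset fK tc _; exact: fsubset_refl.
have normE t : cube t -> (complex.Re `|Cc_dot f f t|)%:C%C = Cc_dot f f t.
  move=> tc; have -> : (complex.Re `|Cc_dot f f t|)%:C%C = `|Cc_dot f f t|.
    by rewrite normc_def.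
  by rewrite ger0_norm // dotE // sumr_ge0 // => p _; rewrite exprn_ge0.
pose S := [set complex.Re `|Cc_dot f f t| | t in setT].
have SE y : S y -> exists2 t, cube t & y%:C%C = Cc_dot f f t.
  move=> [t _ <-]; have tc := frac_part_cube t; exists (frac_part t) => //.
  by rewrite -(lattice_periodic_frac t (@Cc_dot_periodic f f)) normE.
have [M M0 MP] := continuous_bounded_cube (fset_dot_continuous (A := box n K.+1) fc fc).
(* [sup] is a true supremum only for a nonempty bounded set; the bound comes from compactness of the
   cube. *)
have S_ub : has_ubound S.
  exists (complex.Re M) => y /SE[t tc yE].
  have := MP t tc; rewrite -sum_sqr_norm -dotE // -yE normc_def lecE /= => /andP[_].
  by rewrite expr0n addr0 sqrtr_sqr; apply: le_trans; exact: ler_norm.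
have S_ne : S !=set0 by exists (complex.Re `|Cc_dot f f 0|); exists 0.
split=> [|h].
  rewrite /Cc_norm => fe A t tc.
  have le_dot : \sum_(p <- A) `|fibre f t p| ^+ 2 <= Cc_dot f f t.
    rewrite (@Cc_dot_fset f f K t (A `|` box n K.+1)%fset fK tc (fsubsetUr _ _)).
    rewrite -sum_sqr_norm; apply: ler_sum_fsub => [|p]; first exact: fsubsetUl.
    by rewrite exprn_ge0.
  apply: le_trans le_dot _; rewrite -normE // lecR.
  apply: (@le_trans _ _ (supnorm (Cc_dot f f))).
    by apply: sup_ubound => //; exists t.
  have [s0|/ltW s0] := leP 0 (supnorm (Cc_dot f f)); last exact: le_trans (sqr_ge0 _).
  by rewrite -(sqr_sqrtr s0) ler_sqr // nnegrE sqrtr_ge0.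
rewrite /Cc_norm -[leRHS](ger0_norm e0) -sqrtr_sqr ler_wsqrtr //.
apply: ge_sup => // y /SE[t tc yE].
by rewrite -lecR yE dotE // h.
Qed.

Lemma sqr_normD_le (a b : C) : `|a + b| ^+ 2 <= (`|a| ^+ 2) *+ 2 + (`|b| ^+ 2) *+ 2.
Proof.
apply: (@le_trans _ _ ((`|a| + `|b|) ^+ 2)).
  by rewrite lerXn2r ?nnegrE ?addr_ge0 // ler_normD.
rewrite -subr_ge0.
have -> : `|a| ^+ 2 *+ 2 + `|b| ^+ 2 *+ 2 - (`|a| + `|b|) ^+ 2 = (`|a| - `|b|) ^+ 2.
  by ring.
by rewrite real_exprn_even_ge0 // rpredB ?normr_real.
Qed.

Lemma CcB f g : Cc f -> Cc g -> Cc (f - g).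
Proof.
move=> Cf Cg; have [[fc _] [gc _]] := (Cf, Cg).
have [K fK] := Cc_bounded_support Cf; have [L gL] := Cc_bounded_support Cg.
apply: bounded_support_Cc.
  by move=> x; apply: (@cvgB C C Rn (nbhs x) _ f g); [exact: fc|exact: gc].
exists (K + L)%N => x fgx i; rewrite natrD.
have [fx|fx] := eqVneq (f x) 0; last by apply: le_trans (fK x fx i) _; rewrite lerDl.
apply: le_trans (gL x _ i) _; last by rewrite lerDr.
by apply: contra fgx => /eqP gx; rewrite -[(f - g) x]/(f x - g x) fx gx subrr.
Qed.

(** Norm convergence to [Phi] is recovered from the Cauchy property and uniform convergence by
    passing through [xi l], where [l] may depend on [A] while the threshold for [k] does not. *)
Lemma Xi_rep_approx (xi : nat -> Rn -> C) Phi : Xi_rep xi Phi ->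
  forall e : C, 0 < e -> \forall k \near \oo, forall (A : {fset Zn}) t, cube t ->
    \sum_(p <- A) `|fibre (xi k) t p - fibre Phi t p| ^+ 2 <= e.
Proof.
move=> [Cxi cau unif] e /complex_gt0P[r r0 ->].
have r4 : 0 < r / 4 by rewrite divr_gt0.
have s0 : 0 < Num.sqrt (r / 4) by rewrite sqrtr_gt0.
have [[P Q] [/= [N _ NP] [M _ MQ]] PQ] := cau _ s0.
exists N => // k Nk A t tc.
(* After the factor 2 of [sqr_normD_le], the Cauchy part costs [r / 2], and the [#|A|] uniform
   errors cost [2 c #|A|], again at most [r / 2]. *)
pose c : R := r / (4 * (#|` A|.+1)%:R).
have c0 : 0 < c by rewrite divr_gt0 // mulr_gt0.
have d0 : (0 : C) < (Num.sqrt c)%:C%C by rewrite ltcR sqrtr_gt0.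
have /uniform_cvgP/(_ _ d0)[L _ LP] := unif.
pose l := maxn M L.
have kl : Cc_norm (xi k - xi l) <= Num.sqrt (r / 4).
  apply/ltW/(PQ (k, l)); split; [exact: NP|apply: MQ; exact: leq_maxl].
have {}kl := (Cc_norm_leP (ltW s0) (CcB (Cxi k) (Cxi l))).1 kl A t tc.
rewrite sqr_sqrtr ?(ltW r4) // in kl.
have lPhi x : `|xi l x - Phi x| ^+ 2 <= c%:C%C.
  have h : `|xi l x - Phi x| <= (Num.sqrt c)%:C%C.
    by apply: (LP l (leq_maxr _ _) x).
  rewrite -(sqr_sqrtr (ltW c0)) rmorphXn /=.
  by apply: lerXn2r => //; rewrite nnegrE // ler0c sqrtr_ge0.
apply: (@le_trans _ _
  (\sum_(p <- A) (`|fibre (xi k - xi l) t p| ^+ 2 *+ 2 + c%:C%C *+ 2))).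
  apply: ler_sum => p _.
  have -> : fibre (xi k) t p - fibre Phi t p =
      fibre (xi k - xi l) t p + (fibre (xi l) t p - fibre Phi t p).
    by rewrite addrA subrK.
  apply: le_trans (sqr_normD_le _ _) _; rewrite lerD2l lerMn2r; exact: lPhi.
rewrite big_split /=.
apply: (@le_trans _ _ ((r / 2)%:C%C + (r / 2)%:C%C)); last first.
  by rewrite -rmorphD -splitr.
apply: lerD.
  rewrite sumrMnl; apply: (@le_trans _ _ ((r / 4)%:C%C *+ 2)); first by rewrite lerMn2r.
  by rewrite -rmorphMn lecR; lra.
have -> : \sum_(p <- A) c%:C%C *+ 2 = ((#|` A|%:R * (c *+ 2))%:C%C : C).
  by rewrite big_const_seq count_predT iter_addr_0 mulr_natl !rmorphMn.
rewrite lecR.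
have cE : c * (4 * (#|` A|%:R + 1)) = r by rewrite natr1 divfK // gt_eqF // mulr_gt0.
by rewrite -mulr_natl; nra.
Qed.

Lemma Xi_continuous Phi : Xi Phi -> continuous Phi.
Proof.
move=> [xi [Cxi _ unif]]; apply: (uniform_limit_continuous (fmap_proper_filter xi _) _ unif).
by exists 0%N => // k _; have [] := Cxi k.
Qed.

(** Outside a box the approximant [xi k] vanishes on every fibre, so there the tail of [Phi] is the
    tail of the difference. *)
Lemma Xi_tail Phi : Xi Phi -> sqsum_tail (@cube R n) (fibre Phi).
Proof.
move=> [xi rep] e e0; have [k _ kP] := Xi_rep_approx rep e0.
have [Cxi _ _] := rep; have [K xiK] := Cc_bounded_support (Cxi k).
exists (box n K.+1) => B t tc.
apply: le_trans (kP k (leqnn k) (B `\` box n K.+1)%fset t tc).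
rewrite le_eqVlt; apply/orP; left; apply/eqP; apply: eq_big_seq => p /=.
rewrite in_fsetD => /andP[pK _].
have -> : fibre (xi k) t p = 0; last by rewrite sub0r normrN.
by apply/eqP; apply: contraNT pK => h; apply: cube_translate_box tc _; exact: xiK.
Qed.

Lemma tail_bounded Phi : continuous Phi -> sqsum_tail (@cube R n) (fibre Phi) ->
  sqsum_bounded (@cube R n) (fibre Phi).
Proof.
move=> Phic Phit; apply: sqsum_tail_bounded => // p.
have [K K0 KP] := continuous_bounded_cube (fibre_continuous (p := p) Phic).
exists (K ^+ 2) => [|t tc]; first exact: exprn_ge0.
by apply: lerXn2r; rewrite ?nnegrE ?KP.
Qed.

Definition cutoff (k : nat) (x : Rn) : C :=
  Complex (Num.min 1 (Num.max 0 (k%:R + 1 - `|x|))) 0.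

Lemma cutoff_continuous k : continuous (cutoff k).
Proof.
apply: complex_continuous => [x|]; last by move=> x; exact: cst_continuous.
apply: (@continuous_min R Rn (cst 1)); first exact: cst_continuous.
apply: (@continuous_max R Rn (cst 0)); first exact: cst_continuous.
apply: (@cvgB R R Rn (nbhs x) _ (cst (k%:R + 1)) Num.norm); first exact: cst_continuous.
exact: norm_continuous.
Qed.

Lemma cutoff1 k (x : Rn) : `|x| <= k%:R -> cutoff k x = 1.
Proof.
move=> xk; rewrite /cutoff max_r ?min_l //; lra.
Qed.

Lemma cutoff0 k (x : Rn) : k.+1%:R < `|x| -> cutoff k x = 0.
Proof.
rewrite -natr1 => xk; rewrite /cutoff max_l ?min_r //; lra.
Qed.

Lemma cutoff_itv k (x : Rn) : exists2 a : R, 0 <= a <= 1 & cutoff k x = a%:C%C.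
Proof.
eexists; last by [].
rewrite ge_min lexx andbT le_min ler01 /= le_max lexx //.
Qed.

(** The cut-off functions [cutoff k * Phi] represent [Phi]. One estimate, [small], yields both the
    Cauchy property and uniform convergence: functions dominated by [Phi] and vanishing on a large
    ball have small square sums. *)
Lemma tail_Xi Phi : continuous Phi -> sqsum_tail (@cube R n) (fibre Phi) -> Xi Phi.
Proof.
move=> Phic Phit; pose xi k := cutoff k * Phi.
have Cxi k : Cc (xi k).
  apply: bounded_support_Cc.
    by apply: mulC_continuous; [exact: cutoff_continuous|exact: Phic].
  exists k.+1 => x xix i; apply: le_trans (le_mx_norm_coord x i) _.
  rewrite leNgt; apply: contra xix => /cutoff0 c0.
  by rewrite -[xi k x]/(cutoff k x * Phi x) c0 mul0r.
have small (e : R) : 0 < e -> exists N : nat, forall psi : Rn -> C,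
    (forall x, `|psi x| <= `|Phi x|) -> (forall x, `|x| <= N%:R -> psi x = 0) ->
    forall (A : {fset Zn}) t, cube t ->
      \sum_(p <- A) `|fibre psi t p| ^+ 2 <= (e ^+ 2)%:C%C.
  move=> e0; have e2 : (0 : C) < (e ^+ 2)%:C%C by rewrite ltcR exprn_gt0.
  have [A0 A0P] := Phit _ e2; have [N sN] := fset_sub_box A0.
  (* A cube point translated by an element of [box n N] has norm at most [N + 1]. *)
  exists N.+1 => psi psiPhi psi0 A t tc; apply: le_trans (A0P A t tc).
  rewrite (big_fsetID _ (mem A0)) /= big1_fset ?add0r => [|p].
    have -> : [fset p in A | p \notin A0]%fset = (A `\` A0)%fset.
      by apply/fsetP => p; rewrite !inE /= andbC.
    by apply: ler_sum => p _; apply: lerXn2r; rewrite ?nnegrE ?psiPhi.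
  rewrite !inE /= => /andP[_ pA0] _; rewrite /fibre psi0 ?normr0 ?expr0n //.
  rewrite /Num.norm /= mx_normrE; apply: bigmax_le => // -[i j] _ /=.
  have := fsubsetP sN p pA0; rewrite mem_box => /forallP /(_ j).
  have := tc j; rewrite !mxE !ord1 -natr1 => /andP[t0 t1] pN.
  have : `|(p 0 j)%:~R| <= N%:R :> R by rewrite -intr_norm -abszE -pmulrn ler_nat.
  by rewrite !ler_norml => /andP[? ?]; apply/andP; split; lra.
have xi1 k x : `|x| <= k%:R -> xi k x = Phi x.
  by move=> xk; rewrite -[xi k x]/(cutoff k x * Phi x) cutoff1 // mul1r.
exists xi; split=> //.
  move=> e e0; have e20 : 0 < e / 2 by rewrite divr_gt0.
  have [N NP] := small _ e20.
  exists ([set k | (N <= k)%N], [set k | (N <= k)%N]); first by split; exists N.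
  move=> [k l] [/= Nk Nl]; apply: (@le_lt_trans _ _ (e / 2)); last first.
    by rewrite ltr_pdivrMr // ltr_pMr // ltr1n.
  apply/(Cc_norm_leP (ltW e20) (CcB (Cxi k) (Cxi l))); apply: NP => x.
    rewrite -[(xi k - xi l) x]/(cutoff k x * Phi x - cutoff l x * Phi x) -mulrBl.
    have [a a01 ->] := cutoff_itv k x; have [b b01 ->] := cutoff_itv l x.
    rewrite -rmorphB normrM ler_piMl // normc_def /= expr0n addr0 sqrtr_sqr lecR.
    by rewrite ler_norml; lra.
  move=> xN; rewrite -[(xi k - xi l) x]/(xi k x - xi l x).
  by rewrite !xi1 ?subrr // (le_trans xN) // ler_nat.
apply/uniform_cvgP => e /complex_gt0P[r r0 ->]; have [N NP] := small _ r0.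
exists N => // k /= Nk x _.
have xfrac : x = translate (- int_part x) (frac_part x).
  by rewrite /frac_part translateD addNr translate0.
have h : `|xi k x - Phi x| ^+ 2 <= (r ^+ 2)%:C%C.
  (* A single term of the square sum, at the index that carries the cube point back to [x], bounds
     the pointwise error. *)
  have := NP (xi k - Phi) _ _ [fset (- int_part x)%R]%fset _ (frac_part_cube x).
  rewrite big_seq_fset1 /fibre -xfrac; apply=> y.
    rewrite -[(xi k - Phi) y]/(cutoff k y * Phi y - Phi y) -[X in _ - X]mul1r -mulrBl.
    have [a a01 ->] := cutoff_itv k y; rewrite -(rmorph1 (real_complex R)) -rmorphB.
    rewrite normrM ler_piMl // normc_def /= expr0n addr0 sqrtr_sqr lecR.
    by rewrite ler_norml; lra.
  move=> yN; rewrite -[(xi k - Phi) y]/(xi k y - Phi y).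
  by rewrite xi1 ?subrr // (le_trans yN) // ler_nat.
have rC0 : (0 : C) <= r%:C%C by rewrite ler0c ltW.
by move: h; rewrite rmorphXn /= ler_pXn2r ?nnegrE.
Qed.

End CompletionOfCc.

Lemma uniform_cvg_unique (K : numFieldType) (V : pseudoMetricNormedZmodType K)
    (X : choiceType) (T : Type) (F : set_system T) (u : T -> X -> V) h h' :
  ProperFilter F -> {uniform, u @ F --> h} -> {uniform, u @ F --> h'} -> h = h'.
Proof.
move=> FF /uniform_cvgP uh /uniform_cvgP uh'; apply/funext => x.
apply/eqP; rewrite -subr_eq0 -normr_eq0; apply: contraT => hh'.
have d0 : 0 < `|h x - h' x| by rewrite normr_gt0 -normr_eq0.
have e0 : 0 < `|h x - h' x| / 2 / 2 by rewrite !divr_gt0.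
have [k [uk uk']] := filter_ex (filterI (uh _ e0) (uh' _ e0)).
have := lerD (uk x I) (uk' x I); rewrite [X in X + _]distrC -splitr => h1.
have /le_trans /(_ h1) h2 := ler_distD (u k x) (h x) (h' x).
suff : `|h x - h' x| < `|h x - h' x| by rewrite ltxx.
by apply: le_lt_trans h2 _; rewrite ltr_pdivrMr // ltr_pMr // ltr1n.
Qed.

Lemma dot_cvg_eq (C : numClosedFieldType) (X : Type) (D : set X) (I : choiceType)
    (f f' g g' : X -> I -> C) h h' :
  (forall x, D x -> f x = f' x) -> (forall x, D x -> g x = g' x) ->
  (forall x, D x -> h x = h' x) -> dot_cvg D f g h -> dot_cvg D f' g' h'.
Proof.
move=> ff' gg' hh' fgh e e0; have [A0 A0P] := fgh e e0.
by exists A0 => A sA x Dx; rewrite -ff' // -gg' // -hh' //; exact: A0P.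
Qed.

(** For positive [n] the constant vectors make Z^n infinite; being countable, it is then in
    bijection with [nat]. *)
Lemma int_matrix_enum (n : nat) : (1 <= n)%N ->
  exists (e : nat -> 'rV[int]_n) (d : 'rV[int]_n -> nat), cancel e d /\ cancel d e.
Proof.
move=> n0; have inf : infinite_set [set: 'rV[int]_n].
  pose c (k : nat) : 'rV[int]_n := const_mx k%:Z.
  have cI : injective c.
    by move=> k l /rowP /(_ (Ordinal n0)); rewrite !mxE => -[].
  move=> fin; apply: infinite_nat.
  by rewrite -(preimage_setT c); apply: finite_preimage fin => k l _ _; exact: cI.
have /card_set_bijP[d] := eq_card_nat (countableP _) inf.
by rewrite setTT_bijective => -[e de ed]; exists e, d.
Qed.

(** * Coefficients with respect to the lattice basis *)

Section Isomorphism.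
Variables (R : realType) (n : nat).
Local Notation C := R[i].
Local Notation Rn := 'rV[R]_n.
Local Notation Zn := 'rV[int]_n.
Variables (e : nat -> Zn) (d : Zn -> nat).
Hypotheses (ed : cancel e d) (de : cancel d e).
Implicit Types (Phi Psi : Rn -> C) (f : nat -> Rn -> C).

Lemma lattice_fun_supp (m : Zn) (x : Rn) i : lattice_fun m x != 0 ->
  `| `|x ord0 i| - (absz (m ord0 i))%:R | <= 2.
Proof.
move=> mx; apply: shift_fun_supp; apply: contraNneq mx => mx.
by rewrite /lattice_fun (bigD1 i) //= mx mul0r.
Qed.

Definition basis_mx (t : Rn) (j : nat) : Zn -> C := fibre (lattice_fun (e j)) t.
Definition basis_row (j : nat) : {fset Zn} := box n (znorm (e j)).+1.
Definition basis_col (p : Zn) : {fset nat} := [fset d m | m in box n (znorm p).+1]%fset.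

Lemma basis_unitary t : cube t -> finitary_unitary (basis_mx t) basis_row basis_col.
Proof. by move=> tc; exact: (finitary_unitary_reindex ed de (lattice_unitary tc)). Qed.

(** Written as a sum over all translates, the coefficient is visibly periodic and its continuity can
    be proved across the faces of the cube; [zcoefE] identifies it with the matrix form on the
    cube. *)
Definition zcoef Phi (j : nat) : Rn -> C := Cc_dot (lattice_fun (e j)) Phi.

Lemma zcoefE Phi j t : cube t ->
  zcoef Phi j t = transform (basis_mx t) basis_row (fibre Phi t) j.
Proof.
move=> tc; pose K := (znorm (e j)).+2.
rewrite /zcoef (@Cc_dot_fset _ _ _ _ K t (basis_row j `|` box n K.+1)%fset) //.
- by rewrite (transform_widen _ (basis_unitary tc) (fsubsetUl _ (box n K.+1))).
- move=> x h i; have := lattice_fun_supp i h; rewrite ler_norml => /andP[_].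
  rewrite lerBlDl => /le_trans; apply.
  by rewrite /K -(addn2 (znorm _)) natrD lerD2r ler_nat le_znorm.
- exact: fsubsetUr.
Qed.

Lemma zcoef_periodic Phi j : lattice_periodic (zcoef Phi j).
Proof. exact: Cc_dot_periodic. Qed.

Lemma zcoef_frac Phi j t : zcoef Phi j t =
  transform (basis_mx (frac_part t)) basis_row (fibre Phi (frac_part t)) j.
Proof.
rewrite -(lattice_periodic_frac t (@zcoef_periodic Phi j)) zcoefE //.
exact: frac_part_cube.
Qed.

Lemma locally_finite_continuous (I : choiceType) (F : I -> Rn -> C) :
  (forall p, continuous (F p)) ->
  (forall M : nat, exists A : {fset I}, forall x, `|x| <= M%:R ->
    forall p, p \notin A -> F p x = 0) ->
  continuous (fun x => \sum_(p \in [set: I]) F p x).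
Proof.
(* [M] covers the unit ball around [x], on which the sum is one fixed finite sum. *)
move=> Fc Ffin x; pose M := Num.bound (`|x| + 1).
have xM : `|x| + 1 <= M%:R by apply/ltW/archi_boundP; rewrite addr_ge0.
have [A AP] := Ffin M.
have E y : `|y| <= M%:R -> \sum_(p \in [set: I]) F p y = \sum_(p <- A) F p y.
  by move=> yM; apply: fsbigTE => p; exact: AP.
have near_x : nbhs x [set y : Rn | `|y| <= M%:R].
  apply: filterS (nbhsx_ballx x 1 ltr01) => y.
  rewrite -ball_normE /= => xy; apply: le_trans xM.
  rewrite -[y](subrK x) addrC; apply: le_trans (ler_normD _ _) _.
  by rewrite lerD2l distrC ltW.
move=> B; rewrite /= E; last by apply: le_trans xM; rewrite lerDl.
move=> /(sum_continuous (s := A) Fc) h; apply: filterS2 near_x h => y yM.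
by rewrite /= E.
Qed.

Lemma zcoef_continuous Phi j : continuous Phi -> continuous (zcoef Phi j).
Proof.
move=> Phic; apply: locally_finite_continuous => [p|M].
  apply: mulC_continuous; last exact: fibre_continuous.
  move=> t; apply: (@continuous_comp _ _ _ (fun t => fibre (lattice_fun (e j)) t p)).
    by apply: fibre_continuous; exact: lattice_fun_continuous.
  exact: conjC_continuous.
(* A nonzero term has [t - p] within the support radius [znorm (e j) + 2], so [p] exceeds it by at
   most the norm of [t]. *)
exists (box n (M + (znorm (e j)).+2)) => t tM p pA.
have [->|h] := eqVneq (lattice_fun (e j) (translate p t)) 0.
  by rewrite conjC0 mul0r.
case/negP: pA; rewrite mem_box; apply/forallP => i.
have := lattice_fun_supp i h; rewrite ler_norml => /andP[_].
have ti := le_trans (le_mx_norm_coord t i) tM.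
have ei : (absz (e j ord0 i))%:R <= (znorm (e j))%:R :> R.
  by rewrite ler_nat le_znorm.
rewrite !mxE => h1; rewrite -(ler_nat R).
have -> : (absz (p ord0 i))%:R = `|(p ord0 i)%:~R| :> R.
  by rewrite -intr_norm -abszE.
rewrite !ord1 in ti ei h1 *.
have h2 : `|(p 0 i)%:~R| <= `|t 0 i| + `|t 0 i - (p 0 i)%:~R|.
  by rewrite -[X in `|X|](subKr (t 0 i)); exact: ler_normB.
rewrite -(addn2 (znorm _)) addnA !natrD; lra.
Qed.

(** The sum is finite at every point: [lattice_fun (e j) x] vanishes unless the coordinates of [e j]
    and [x] are within 2 in absolute value. *)
Definition zsynth f : Rn -> C := fun x =>
  \sum_(j \in [set: nat]) lattice_fun (e j) x * f j x.

Lemma zsynth_continuous f : (forall j, continuous (f j)) -> continuous (zsynth f).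
Proof.
move=> fc; apply: locally_finite_continuous => [j|M].
  by apply: mulC_continuous; [exact: lattice_fun_continuous|exact: fc].
exists [fset d m | m in box n M.+2]%fset => x xM j jA.
have [->|h] := eqVneq (lattice_fun (e j) x) 0; first by rewrite mul0r.
case/negP: jA; apply/imfsetP; exists (e j) => //=.
rewrite mem_box; apply/forallP => i.
have := lattice_fun_supp i h; rewrite ler_norml => /andP[h1 _].
have xi := le_trans (le_mx_norm_coord x i) xM.
by rewrite -(ler_nat R) -(addn2 M) natrD; lra.
Qed.

(** Periodic coefficients are constant along a fibre, so synthesis acts there as the adjoint
    matrix. *)
Lemma fibre_zsynth f t : (forall j, lattice_periodic (f j)) -> cube t ->
  fibre (zsynth f) t = transform (adjoint_mx (basis_mx t)) basis_col (f ^~ t).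
Proof.
move=> fp tc; apply/funext => p; rewrite /fibre /zsynth.
rewrite (fsbigTE (basis_col p)) => [|j jp]; last first.
  have [_ h _ _] := basis_unitary tc.
  have /eqP-> : lattice_fun (e j) (translate p t) == 0; last by rewrite mul0r.
  by apply: contraNT jp => /h.
by apply: eq_bigr => j _; rewrite /adjoint_mx conjCK fp.
Qed.

Lemma zcoefK f : (forall j, lattice_periodic (f j)) -> zcoef (zsynth f) = f.
Proof.
move=> fp; apply/funext => j; apply/funext => t.
have tc := frac_part_cube t.
rewrite zcoef_frac fibre_zsynth // -[RHS](lattice_periodic_frac t (fp j)).
have := congr1 (@^~ j)
  (transformK (adjoint_unitary (basis_unitary tc)) (f ^~ (frac_part t))).
rewrite /= => <-; congr (transform _ _ _ j).
by apply/funext => k; apply/funext => p; rewrite /adjoint_mx conjCK.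
Qed.

Lemma zsynthK Phi : zsynth (zcoef Phi) = Phi.
Proof.
apply/funext => x; have xc := frac_part_cube x.
have {2}-> : x = translate (- int_part x) (frac_part x).
  by rewrite /frac_part translateD addNr translate0.
have -> : zsynth (zcoef Phi) x =
    fibre (zsynth (zcoef Phi)) (frac_part x) (- int_part x).
  by rewrite /fibre /frac_part translateD addNr translate0.
rewrite fibre_zsynth // => [|j]; last exact: zcoef_periodic.
have -> : (zcoef Phi) ^~ (frac_part x) =
    transform (basis_mx (frac_part x)) basis_row (fibre Phi (frac_part x)).
  by apply/funext => j; rewrite zcoefE.
by rewrite (transformK (basis_unitary xc)).
Qed.

Lemma zcoefD Phi Psi : zcoef (Phi + Psi) = zcoef Phi + zcoef Psi.
Proof.
apply/funext => j; apply/funext => t.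
rewrite -[RHS]/(zcoef Phi j t + zcoef Psi j t) !zcoef_frac /transform -big_split /=.
by apply: eq_bigr => p _; rewrite -mulrDr.
Qed.

Lemma zcoef_act Phi a : CT a -> zcoef (Xi_act Phi a) = l2_act (zcoef Phi) a.
Proof.
move=> [_ ap]; apply/funext => j; apply/funext => t.
rewrite -[RHS]/(zcoef Phi j t * a t) !zcoef_frac /transform mulr_suml.
apply: eq_bigr => p _; rewrite -mulrA; congr (_ * _).
by rewrite -[LHS]/(Phi _ * a _) ap /frac_part ap.
Qed.

(** A single [h] serves as limit of both pairings: it is obtained from the coefficients and carried
    back to the functions by the adjoint unitaries. Equality of the inner products follows. *)
Lemma zcoef_dot Phi Psi :
  continuous Phi -> sqsum_tail (@cube R n) (fibre Phi) ->
  continuous Psi -> sqsum_tail (@cube R n) (fibre Psi) ->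
  exists h : Rn -> C, [/\ lattice_periodic h,
    dot_cvg setT (fun t => (zcoef Phi) ^~ t) (fun t => (zcoef Psi) ^~ t) h
  & dot_cvg (@cube R n) (fibre Phi) (fibre Psi) h].
Proof.
move=> Phic Phit Psic Psit.
have Phib := tail_bounded Phic Phit; have Psib := tail_bounded Psic Psit.
(* Small tails of the coefficients are read off from the convergence of [Phi] paired with itself,
   which the unitaries preserve. *)
have [h1 h1P] := dot_cvg_exists Phit Phib.
have UPhit := dot_cvg_tail (transform_dot_cvg basis_unitary Phit Phib h1P).
have UPsib := transform_bounded basis_unitary Psib.
have [h0 h0P] := dot_cvg_exists UPhit UPsib.
pose h t := h0 (frac_part t).
have hP : dot_cvg setT (fun t => (zcoef Phi) ^~ t) (fun t => (zcoef Psi) ^~ t) h.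
  move=> r r0; have [A0 A0P] := h0P r r0; exists A0 => A sA t _.
  under eq_bigr => j _ do rewrite !zcoef_frac.
  by apply: A0P => //; exact: frac_part_cube.
exists h; split => //; first by move=> p t; rewrite /h frac_part_translate.
(* On the faces of the cube [t] and [frac_part t] may differ; periodicity of the coefficients makes
   [h] the limit at [t] as well. *)
have hc : dot_cvg (@cube R n)
    (fun t => transform (basis_mx t) basis_row (fibre Phi t))
    (fun t => transform (basis_mx t) basis_row (fibre Psi t)) h.
  move=> r r0; have [A0 A0P] := hP r r0; exists A0 => A sA t tc.
  by under eq_bigr => j _ do rewrite -!zcoefE //; exact: A0P.
have := transform_dot_cvg (fun t tc => adjoint_unitary (basis_unitary tc)) UPhit UPsib hc.
by apply: dot_cvg_eq => t tc //; exact: transformK (basis_unitary tc) _.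
Qed.

End Isomorphism.

(** * Evaluation of the two inner products and the convergence criterion *)

Section InnerProducts.
Variables (R : realType) (n : nat).
Local Notation C := R[i].
Local Notation Rn := 'rV[R]_n.
Local Notation Zn := 'rV[int]_n.
Implicit Types (Phi Psi h : Rn -> C) (xi eta : nat -> Rn -> C).

Lemma Xi_rep_dot_cvg xi eta Phi Psi h : Xi_rep xi Phi -> Xi_rep eta Psi ->
  lattice_periodic h -> dot_cvg (@cube R n) (fibre Phi) (fibre Psi) h ->
  {uniform, (fun k => Cc_dot (xi k) (eta k)) @ \oo --> h}.
Proof.
move=> rep1 rep2 hp PPh; apply/uniform_cvgP => e e0.
have [XiPhi XiPsi] : Xi Phi /\ Xi Psi by split; [exists xi|exists eta].
have [K1 K10 K1P] := tail_bounded (Xi_continuous XiPhi) (Xi_tail XiPhi).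
have [K2 K20 K2P] := tail_bounded (Xi_continuous XiPsi) (Xi_tail XiPsi).
have e20 : 0 < e / 2 by rewrite divr_gt0.
have e40 : 0 < e / 2 / 2 by rewrite divr_gt0.
(* This bounds the square sums of [eta k], seen as [Psi] plus a difference whose square sum is at
   most 1. *)
have K3 : 0 < 1 *+ 2 + K2 *+ 2 by rewrite addr_gt0 // mulrn_wgt0.
have [d1 d10 d1P] := norm_dot_small Zn K3 e40.
have [d2 d20 d2P] := norm_dot_small Zn K10 e40.
have [A0 A0P] := PPh _ e20.
near=> k => s _.
have h1 : forall (A : {fset Zn}) t, cube t ->
  \sum_(p <- A) `|fibre (xi k) t p - fibre Phi t p| ^+ 2 <= d1.
  by near: k; exact: Xi_rep_approx rep1 _ d10.
have h2 : forall (A : {fset Zn}) t, cube t ->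
  \sum_(p <- A) `|fibre (eta k) t p - fibre Psi t p| ^+ 2 <= d2.
  by near: k; exact: Xi_rep_approx rep2 _ d20.
have h3 : forall (A : {fset Zn}) t, cube t ->
  \sum_(p <- A) `|fibre (eta k) t p - fibre Psi t p| ^+ 2 <= 1.
  by near: k; exact: Xi_rep_approx rep2 _ ltr01.
rewrite -(lattice_periodic_frac s hp).
rewrite -(lattice_periodic_frac s (@Cc_dot_periodic _ _ (xi k) (eta k))).
have := frac_part_cube s; move: (frac_part s) => t tc.
have [Cxi _ _] := rep1; have [K xiK] := Cc_bounded_support (Cxi k).
pose A := (A0 `|` box n K.+1)%fset.
rewrite (Cc_dot_fset (eta k) xiK tc (fsubsetUr A0 _)) -/A.
have -> : \sum_(p <- A) (fibre (xi k) t p)^* * fibre (eta k) t p =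
    \sum_(p <- A) (fibre (xi k) t p - fibre Phi t p)^* * fibre (eta k) t p +
    \sum_(p <- A) (fibre Phi t p)^* * (fibre (eta k) t p - fibre Psi t p) +
    \sum_(p <- A) (fibre Phi t p)^* * fibre Psi t p.
  rewrite -!big_split /=; apply: eq_bigr => p _.
  by rewrite rmorphB /=; ring.
rewrite -addrA [leRHS]splitr; apply: le_trans (ler_normD _ _) (lerD _ _).
  rewrite [leRHS]splitr; apply: le_trans (ler_normD _ _) (lerD _ _).
    apply: d1P; first exact: h1.
    apply: (@le_trans _ _ (\sum_(p <- A) (`|fibre (eta k) t p - fibre Psi t p| ^+ 2 *+ 2
        + `|fibre Psi t p| ^+ 2 *+ 2))).
      apply: ler_sum => p _.
      by rewrite -{1}[fibre (eta k) t p](subrK (fibre Psi t p)) sqr_normD_le.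
    by rewrite big_split /= !sumrMnl; apply: lerD; rewrite lerMn2r ?h3 ?K2P.
  (* Conjugation swaps the two factors, putting the small one first as [d2P] expects. *)
  rewrite -norm_conjC rmorph_sum /=.
  under eq_bigr => p _ do rewrite rmorphM /= conjCK mulrC.
  by apply: d2P; [exact: h2|exact: K1P].
by apply: A0P => //; exact: fsubsetUl.
Unshelve. all: by end_near. Qed.

(** The function [h] is a limit for every choice of representatives, and one choice already
    determines it, so [get] returns it. *)
Lemma Xi_dotE Phi Psi h : Xi Phi -> Xi Psi -> lattice_periodic h ->
  dot_cvg (@cube R n) (fibre Phi) (fibre Psi) h -> Xi_dot Phi Psi = h.
Proof.
move=> [xi rep1] [eta rep2] hp PPh; apply: xget_unique => [xi' eta' rep1' rep2'|h' h'P].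
  exact: Xi_rep_dot_cvg rep1' rep2' hp PPh.
apply: uniform_cvg_unique (h'P _ _ rep1 rep2) _.
exact: Xi_rep_dot_cvg rep1 rep2 hp PPh.
Qed.

Lemma l2_dotE (f g : nat -> Rn -> C) h :
  dot_cvg setT (fun t => f ^~ t) (fun t => g ^~ t) h -> l2_dot f g = h.
Proof.
move=> fgh.
have fg : {uniform,
    (fun N (t : Rn) => \sum_(j < N) (f j t)^* * g j t : C) @ \oo --> h}.
  by apply/uniform_cvgP => e e0; exact: dot_cvg_nat fgh _ e0.
apply: xget_unique => // h' fgh'; exact: uniform_cvg_unique fgh' fg.
Qed.

Lemma XiP Phi : Xi Phi <-> continuous Phi /\ sqsum_tail (@cube R n) (fibre Phi).
Proof.
split=> [XiPhi|[]]; last exact: tail_Xi.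
by split; [exact: Xi_continuous|exact: Xi_tail].
Qed.

Lemma translates_sum_cvg_unifP Phi : continuous Phi ->
  translates_sum_cvg_unif Phi <-> sqsum_tail (@cube R n) (fibre Phi).
Proof.
move=> Phic; have FF : Filter (@totally Zn) by exact: totally_filter.
split=> [[s /uniform_cvgP sP]|Phit].
  apply: (@dot_cvg_tail _ _ _ _ _ s) => e e0; have [A0 _ A0P] := sP _ e0.
  exists A0 => A sA t tc; rewrite -sum_sqr_norm; exact: A0P.
have [h hP] := dot_cvg_exists Phit (tail_bounded Phic Phit).
exists h; apply/uniform_cvgP => e e0; have [A0 A0P] := hP e e0.
exists A0 => // A sA t tc.
by have := A0P A sA t tc; rewrite -sum_sqr_norm.
Qed.

End InnerProducts.

(** * The coefficient map between Xi and l^2(C(T^n)) *)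

Section MainProof.
Variables (R : realType) (n : nat).
Local Notation C := R[i].
Local Notation Rn := 'rV[R]_n.
Local Notation Zn := 'rV[int]_n.
Variables (e : nat -> Zn) (d : Zn -> nat).
Hypotheses (ed : cancel e d) (de : cancel d e).

Lemma zcoef_l2 (Phi : Rn -> C) : Xi Phi -> l2 (zcoef e Phi).
Proof.
move=> /XiP[Phic Phit]; have zcoefc j := zcoef_continuous (e := e) (j := j) Phic.
split; first by move=> j; split; [exact: zcoefc|exact: zcoef_periodic].
have [h [hp hP _]] := zcoef_dot ed de Phic Phit Phic Phit.
have unif : {uniform,
    (fun N (t : Rn) => \sum_(j < N) `|zcoef e Phi j t| ^+ 2 : C) @ \oo --> h}.
  apply/uniform_cvgP => r r0; apply: filterS (dot_cvg_nat hP r0) => N hN t _.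
  have := hN t I; congr (`|_ - _| <= _).
  by apply: eq_bigr => j _; rewrite normCK mulrC.
have partc N : continuous (fun t : Rn => \sum_(j < N) `|zcoef e Phi j t| ^+ 2 : C).
  have -> : (fun t : Rn => \sum_(j < N) `|zcoef e Phi j t| ^+ 2 : C) =
      (fun t => \sum_(j < N) (zcoef e Phi j t)^* * zcoef e Phi j t).
    by apply/funext => t; apply: eq_bigr => j _; rewrite normCK mulrC.
  apply: sum_continuous => j; apply: mulC_continuous; last exact: zcoefc.
  move=> t; apply: (@continuous_comp _ _ _ (zcoef e Phi j)); first exact: zcoefc.
  exact: conjC_continuous.
exists h; [split; [|exact: hp] | exact: unif].
(* The limit [h] was built from [frac_part], which jumps; its continuity comes from the continuous
   partial sums. *)
apply: (uniform_limit_continuous (fmap_proper_filter _ _) _ unif).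
exists 0%N; first exact: I.
by move=> N _; exact: (partc N).
Qed.

(** Tails of [f] on the cube pass through the adjoint unitaries to tails on the fibres of the
    synthesis, which characterise [Xi]. *)
Lemma zsynth_Xi (f : nat -> Rn -> C) : l2 f -> Xi (zsynth e f).
Proof.
move=> [fCT [g _ /uniform_cvgP fg]].
have fc j : continuous (f j) by have [] := fCT j.
have fp j : lattice_periodic (f j) by have [_] := fCT j.
have ft : sqsum_tail (@cube R n) (fun t => f ^~ t).
  apply: (@nat_cvg_tail _ _ _ _ g) => r r0; apply: filterS (fg r r0) => N h t _.
  exact: h.
have fb : sqsum_bounded (@cube R n) (fun t => f ^~ t).
  apply: sqsum_tail_bounded ft _ => j.
  have [K K0 KP] := continuous_bounded_cube (fc j).
  exists (K ^+ 2) => [|t tc]; first exact: exprn_ge0.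
  by apply: lerXn2r; rewrite ?nnegrE ?KP.
apply/XiP; split; first exact: (zsynth_continuous ed).
have [h hP] := dot_cvg_exists ft fb.
have VU (t : Rn) (tc : cube t) := adjoint_unitary (basis_unitary ed de tc).
apply: (@dot_cvg_tail _ _ _ _ _ h).
have VUh := transform_dot_cvg VU ft fb hP.
by apply: dot_cvg_eq VUh => t tc //; rewrite (fibre_zsynth ed de).
Qed.

End MainProof.

Theorem theorem2p1 (R : realType) (n : nat) (hn : (1 <= n)%N) :
  hilbert_iso (@Xi R n) (@Xi_act R n) (@Xi_dot R n)
              (@l2 R n) (@l2_act R n) (@l2_dot R n) /\
  (forall Phi : 'rV[R]_n -> R[i], continuous Phi ->
     (Xi Phi <-> translates_sum_cvg_unif Phi)).
Proof.
split; last first.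
  move=> Phi Phic; rewrite translates_sum_cvg_unifP //; split=> [/XiP[]//|Phit].
  by apply/XiP.
have [e [d [ed de]]] := int_matrix_enum hn.
exists (zcoef e); split.
- split=> [Phi|Phi Psi _ _ PhiPsi|f fl2]; first exact: (zcoef_l2 ed de).
    by rewrite -(zsynthK ed de Phi) PhiPsi (zsynthK ed de).
  have fp j : lattice_periodic (f j) by have [/(_ j)[]] := fl2.
  by exists (zsynth e f); [exact: (zsynth_Xi ed de)|exact: (zcoefK ed de fp)].
- by move=> Phi Psi _ _; exact: (zcoefD ed de).
- by move=> Phi a _; exact: (zcoef_act ed de).
- move=> Phi Psi XiPhi XiPsi.
  have [[Phic Phit] [Psic Psit]] := ((XiP Phi).1 XiPhi, (XiP Psi).1 XiPsi).
  have [h [hp hl2 hXi]] := zcoef_dot ed de Phic Phit Psic Psit.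
  by rewrite (l2_dotE hl2) (Xi_dotE XiPhi XiPsi hp hXi).
Qed.
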